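(* Let $\delta$ be a maximal coaction of a discrete group $G$ on a $C^*$-algebra $B$, and let $H$ be a Hecke subgroup of $G$ (i.e. $(G,H)$ is a discrete Hecke pair). Suppose $\pi\times\nu$ is a representation of the Echterhoff–Quigg crossed product $B\times_{\delta|}(G/H)$ on a Hilbert space $\mathcal{K}$. Then $\pi\times\nu$ is unitarily equivalent to a regular representation if and only if there exists a representation $V$ of the Hecke algebra $\mathcal{H}(G,H)$ on $\mathcal{K}$ such that $(\nu,V)$ is a covariant pair and such that the range of $V$ commutes with the range of $\pi$.
   Context: Hecke algebras. A discrete Hecke pair $(G,H)$ is a discrete group $G$ with a subgroup $H$ such that every double coset $HxH$ contains only finitely many left cosets of $H$. $\mathcal{H}(G,H)$ is the $*$-algebra of finitely supported complex functions on $H\backslash G/H$ with $fg(HxH)=\sum_{yH\in G/H} f(HyH)g(Hy^{-1}xH)$ and $f^*(HxH)=\overline{f(Hx^{-1}H)}$. $[HxH]$ is the characteristic function of $HxH$, and $\epsilon_{xH}$ is the characteristic function of the point $xH\in G/H$. Representations of $C^*$-algebras are nondegenerate $*$-homomorphisms into bounded operators on a Hilbert space; representations of Hecke algebras are unital $*$-representations by bounded operators. A pair $(\nu,V)$ of representations of $c_0(G/H)$ and $\mathcal{H}(G,H)$ on the same Hilbert space is a covariant pair if for all $a,x,b\in G$ $$V([HaH])\nu(\epsilon_{xH})V([HbH])=\sum_{uH\subseteq Ha^{-1}H,\ vH\subseteq HbH}\nu(\epsilon_{xuH})V([Hu^{-1}vH])\nu(\epsilon_{xvH}),$$ the sum being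 over left cosets. Coactions and Fell bundles. Let $\delta:B\to B\otimes C^*(G)$ be a coaction of the discrete group $G$. The spectral subspaces $B_x=\{b\in B:\delta(b)=b\otimes x\}$ ($x\in G$) form a Fell bundle $\mathcal{B}$ over $G$; they satisfy $B_xB_y\subseteq B_{xy}$, $B_x^*=B_{x^{-1}}$, and $\bigcup_x B_x$ spans the dense $*$-subalgebra $\Gamma_c(\mathcal{B})$ of $B$. Since $G$ is discrete, $\delta$ is maximal if and only if $B$ is (canonically) isomorphic to $C^*(\mathcal{B})$, the universal enveloping $C^*$-algebra of $\Gamma_c(\mathcal{B})$. Echterhoff–Quigg crossed product. Let $\Gamma_c(\mathcal{B}\times G/H)$ be the $*$-algebra of finitely supported sections of the Fell bundle $\mathcal{B}\times G/H$ over the transformation groupoid $G\times G/H$; it is spanned by elements $(b_x,yH)$ with $x,y\in G$, $b_x\in B_x$ (linear in $b_x$), with $(b_x,yH)(c_z,wH)=(b_xc_z,wH)$ if $yH=zwH$ and $0$ otherwise, and $(b_x,yH)^*=(b_x^*,xyH)$. Its universal enveloping $C^*$-algebra is denoted $C^*(\mathcal{B}\times G/H)=B\times_{\delta|}(G/H)$ and called the Echterhoff–Quigg crossed product. Representations $\pi$ of $B$ and $\nu$ of $c_0(G/H)$ on the same Hilbert space form a covariant representation $(\pi,\nu)$ of $(B,G/H,\delta|)$ if $\pi(b_x)\nu(\epsilon_{yH})=\nu(\epsilon_{xyH})\pi(b_x)$ for all $x,y\in G$, $b_x\in B_x$. Each such pair has a unique integrated form $\pi\times\nu$, a representation of $B\times_{\delta|}(G/H)$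 with $(\pi\times\nu)(b,xH)=\pi(b)\nu(\epsilon_{xH})$; since $\delta$ is maximal, every representation of $B\times_{\delta|}(G/H)$ is of this form. Regular representations. Let $\lambda$ be the quasi-regular representation of $G$ on $\ell^2(G/H)$, $\lambda_x\epsilon_{yH}=\epsilon_{xyH}$, and let $M$ be the representation of $c_0(G/H)$ on $\ell^2(G/H)$ by multiplication. For a representation $\theta$ of $B$ on $\mathcal{K}_\theta$, the pair $((\theta\otimes\lambda)\circ\delta,1\otimes M)$ is a covariant representation of $(B,G/H,\delta|)$ on $\mathcal{K}_\theta\otimes\ell^2(G/H)$; its integrated form is the regular representation induced by $\theta$. A regular representation is one of this form for some $\theta$. *)

(* Defs.v *)
From HB Require Import structures.
From mathcomp Require Import all_boot all_order all_algebra.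
From mathcomp Require Import sesquilinear complex.
From mathcomp Require Import all_classical all_reals all_analysis.
Import numFieldNormedType.Exports.
Import Order.TTheory GRing.Theory Num.Theory.

Set Implicit Arguments.
Unset Strict Implicit.
Unset Printing Implicit Defensive.

Local Open Scope classical_set_scope.
Local Open Scope quotient_scope.
Local Open Scope ring_scope.

(* Objects that the theory only knows up to canonical isomorphism (C*(G),
   minimal tensor products, enveloping C*-algebras, Hilbert tensor products,
   l^2(I)) are not constructed: a predicate says that a given space, together
   with its canonical maps, is a model of the object. *)

(* The form is linear in its first argument. *)
Record hilbert (R : realType) := Hilbert {
  hilbert_space :> completeNormedModType R[i];
  inner : {dot hilbert_space for Num.conj};
  inner_norm : forall v, `|v| ^+ 2 = inner v v }.

Arguments inner {R h}.

Definition lspan (F : numFieldType) (V : lmodType F) (S : set V) : set V :=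
  [set v | exists (n : nat) (c : 'I_n -> F) (w : 'I_n -> V),
    (forall i, S (w i)) /\ v = \sum_i c i *: w i].

Definition bounded_operator (F : numFieldType) (K L : normedModType F)
    (T : K -> L) : Prop :=
  linear T /\ exists M : F, forall v, `|T v| <= M * `|v|.

Definition unitary (R : realType) (K L : hilbert R) (U : K -> L) : Prop :=
  [/\ linear U,
      (forall v w, inner (U v) (U w) = inner v w)
    & (forall w, exists v, U v = w)].

(* (T, t) is the Hilbert space tensor product of K and L. *)
Definition hilbert_tensor (R : realType) (K L T : hilbert R)
    (t : K -> L -> T) : Prop :=
  [/\ (forall v, linear (t v)),
      (forall w, linear (t ^~ w)),
      (forall v w v' w', inner (t v w) (t v' w') = inner v v' * inner w w')
    & dense (lspan [set z | exists v w, z = t v w])].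

(* L is l^2(I), with e i the point mass at i. *)
Definition l2_space (R : realType) (I : eqType) (L : hilbert R)
    (e : I -> L) : Prop :=
  (forall i j, inner (e i) (e j) = (i == j)%:R) /\ dense (lspan (range e)).

(* A *-algebra presented as a subspace of a vector space (typically of a space
   of functions); only the values of the operations on the subspace matter. *)
Record star_algebra (R : realType) := StarAlgebra {
  ambient :> lmodType R[i];
  carrier : set ambient;
  smul : ambient -> ambient -> ambient;
  sstar : ambient -> ambient }.

Arguments carrier {R} s.
Arguments smul {R s}.
Arguments sstar {R s}.

(* Not assumed to be unital. *)
Record cstar_algebra (R : realType) := CStarAlgebra {
  cstar_space :> completeNormedModType R[i];
  cmul : cstar_space -> cstar_space -> cstar_space;
  cstar : cstar_space -> cstar_space;
  cmulA : forall a b c, cmul a (cmul b c) = cmul (cmul a b) c;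
  cmul_linearr : forall a, linear (cmul a);
  cmul_linearl : forall b, linear (cmul ^~ b);
  cstar_conjlinear : forall (z : R[i]) a b,
    cstar (z *: a + b) = Num.conj z *: cstar a + cstar b;
  cstarK : forall a, cstar (cstar a) = a;
  cstarM : forall a b, cstar (cmul a b) = cmul (cstar b) (cstar a);
  cnormM : forall a b, `|cmul a b| <= `|a| * `|b|;
  cnorm_star : forall a, `|cmul (cstar a) a| = `|a| ^+ 2 }.

Arguments cmul {R _}.
Arguments cstar {R _}.

Definition cstar_alg (R : realType) (B : cstar_algebra R) : star_algebra R :=
  @StarAlgebra R B setT cmul cstar.

Definition star_hom (R : realType) (A : star_algebra R) (B : cstar_algebra R)
    (f : A -> B) : Prop :=
  [/\ (forall (z : R[i]) a b, carrier A a -> carrier A b ->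
         f (z *: a + b) = z *: f a + f b),
      (forall a b, carrier A a -> carrier A b ->
         f (smul a b) = cmul (f a) (f b))
    & (forall a, carrier A a -> f (sstar a) = cstar (f a))].

Definition star_rep (R : realType) (A : star_algebra R) (K : hilbert R)
    (rho : A -> K -> K) : Prop :=
  [/\ (forall a, carrier A a -> bounded_operator (rho a)),
      (forall (z : R[i]) a b v, carrier A a -> carrier A b ->
         rho (z *: a + b) v = z *: rho a v + rho b v),
      (forall a b v, carrier A a -> carrier A b ->
         rho (smul a b) v = rho a (rho b v))
    & (forall a v w, carrier A a ->
         inner (rho (sstar a) v) w = inner v (rho a w))].

Definition nondegenerate (R : realType) (A : star_algebra R) (K : hilbert R)
    (rho : A -> K -> K) : Prop :=
  dense (lspan [set w | exists a v, carrier A a /\ w = rho a v]).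

Definition representation (R : realType) (A : star_algebra R) (K : hilbert R)
    (rho : A -> K -> K) : Prop :=
  star_rep rho /\ nondegenerate rho.

Definition unitarily_equivalent (R : realType) (A : star_algebra R)
    (K L : hilbert R) (rho : A -> K -> K) (sigma : A -> L -> L) : Prop :=
  exists U : K -> L, unitary U /\
    forall a v, carrier A a -> U (rho a v) = sigma a (U v).

(* X, with iota, is the universal enveloping C*-algebra of A. *)
Definition enveloping (R : realType) (A : star_algebra R) (X : cstar_algebra R)
    (iota : A -> X) : Prop :=
  [/\ star_hom iota,
      dense (iota @` carrier A)
    & forall (K : hilbert R) (rho : A -> K -> K), representation rho ->
        exists Phi : cstar_alg X -> K -> K, representation Phi /\
          forall a v, carrier A a -> Phi (iota a) v = rho a v].

(* (T, t) is the minimal (spatial) tensor product of A and B: the norm of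
   sum_i a_i (x) b_i is the supremum, over all pairs of representations theta
   and sigma, of the operator norm of sum_i theta(a_i) (x) sigma(b_i). *)
Definition min_tensor (R : realType) (A B T : cstar_algebra R)
    (t : A -> B -> T) : Prop :=
  [/\ (forall a, linear (t a)) /\ (forall b, linear (t ^~ b)),
      (forall a b a' b', cmul (t a b) (t a' b') = t (cmul a a') (cmul b b')),
      (forall a b, cstar (t a b) = t (cstar a) (cstar b)),
      dense (lspan [set z | exists a b, z = t a b])
    & forall (n : nat) (a : 'I_n -> A) (b : 'I_n -> B) (r : R[i]), 0 <= r ->
        `|\sum_i t (a i) (b i)| <= r <->
        forall (K L M : hilbert R) (m : K -> L -> M)
          (theta : cstar_alg A -> K -> K) (sigma : cstar_alg B -> L -> L),
          hilbert_tensor m -> representation theta -> representation sigma ->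
          forall (p : nat) (v : 'I_p -> K) (w : 'I_p -> L),
            `|\sum_i \sum_j m (theta (a i) (v j)) (sigma (b i) (w j))|
              <= r * `|\sum_j m (v j) (w j)| ].

Definition c0 (R : realType) (I : Type) : star_algebra R :=
  @StarAlgebra R (I -> R[i])
    [set f | forall eps : R[i], 0 < eps -> finite_set [set i | eps <= `|f i|]]
    (fun f g i => f i * g i) (fun f i => Num.conj (f i)).

Definition pointmass (R : realType) (I : eqType) (i : I) : I -> R[i] :=
  fun j => (j == i)%:R.

Arguments pointmass R {I} i.

Definition unitary_rep (R : realType) (G : groupType) (K : hilbert R)
    (U : G -> K -> K) : Prop :=
  [/\ (forall x, unitary (U x)),
      (forall v, U 1%g v = v)
    & (forall x y v, U (x * y)%g v = U x (U y v))].

(* A is C*(G), with u the canonical map of G into its unitaries. *)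
Definition group_cstar (R : realType) (G : groupType) (A : cstar_algebra R)
    (u : G -> A) : Prop :=
  [/\ (forall a, cmul (u 1%g) a = a) /\ (forall a, cmul a (u 1%g) = a),
      (forall x y, u (x * y)%g = cmul (u x) (u y)),
      (forall x, u x^-1%g = cstar (u x)),
      dense (lspan (range u))
    & forall (K : hilbert R) (U : G -> K -> K), unitary_rep U ->
        exists rho : cstar_alg A -> K -> K, representation rho /\
          forall x v, rho (u x) v = U x v].

Section Cosets.
Variables (G : groupType) (H : groupClosed G).

Definition lcoset_rel : rel G := fun x y => (x^-1 * y)%g \in H.

Lemma lcoset_rel_refl : reflexive lcoset_rel.
Proof. by move=> x; rewrite /lcoset_rel mulVg gpred1. Qed.

Lemma lcoset_rel_sym : symmetric lcoset_rel.
Proof. by move=> x y; rewrite /lcoset_rel -gpredV invgM invgK. Qed.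

Lemma lcoset_rel_trans : transitive lcoset_rel.
Proof.
move=> y x z xy yz; rewrite /lcoset_rel.
by rewrite -[z](mulVKg y) mulgA gpredM.
Qed.

Canonical lcoset_equiv :=
  EquivRel lcoset_rel lcoset_rel_refl lcoset_rel_sym lcoset_rel_trans.

Definition lcosets := {eq_quot lcoset_rel}.
HB.instance Definition _ := Choice.on lcosets.
HB.instance Definition _ := Quotient.on lcosets.

Definition dcoset_rel : rel G := fun x y =>
  `[< exists h k, [/\ h \in H, k \in H & y = (h * x * k)%g] >].

Lemma dcoset_rel_refl : reflexive dcoset_rel.
Proof.
by move=> x; apply/asboolP; exists 1%g, 1%g; rewrite !gpred1 mul1g mulg1.
Qed.

Lemma dcoset_rel_sym : symmetric dcoset_rel.
Proof.
suff imp x y : dcoset_rel x y -> dcoset_rel y x.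
  by move=> x y; apply/idP/idP; exact: imp.
move=> /asboolP[h [k [hH kH ->]]]; apply/asboolP.
exists h^-1%g, k^-1%g; rewrite !gpredV; split=> //.
by rewrite !mulgA mulVg mul1g mulgK.
Qed.

Lemma dcoset_rel_trans : transitive dcoset_rel.
Proof.
move=> y x z /asboolP[h [k [hH kH ->]]] /asboolP[h' [k' [h'H k'H ->]]].
apply/asboolP; exists (h' * h)%g, (k * k')%g; rewrite !gpredM //.
by split=> //; rewrite !mulgA.
Qed.

Canonical dcoset_equiv :=
  EquivRel dcoset_rel dcoset_rel_refl dcoset_rel_sym dcoset_rel_trans.

Definition dcosets := {eq_quot dcoset_rel}.
HB.instance Definition _ := Choice.on dcosets.
HB.instance Definition _ := Quotient.on dcosets.

Definition lcoset (x : G) : lcosets := \pi_lcosets x.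
Definition dcoset (x : G) : dcosets := \pi_dcosets x.

Definition lcoset_act (x : G) (y : lcosets) : lcosets := lcoset (x * repr y)%g.

Definition lcosets_in (D : dcosets) : set lcosets :=
  [set y | [set z | lcoset z = y] `<=` [set z | dcoset z = D]].

Definition hecke_pair : Prop := forall D : dcosets, finite_set (lcosets_in D).

Definition hecke_algebra (R : realType) : star_algebra R :=
  @StarAlgebra R (dcosets -> R[i])
    [set f | finite_set [set D | f D <> 0]]
    (fun f g D => \sum_(y \in [set: lcosets])
       f (dcoset (repr y)) * g (dcoset ((repr y)^-1 * repr D)%g))
    (fun f D => Num.conj (f (dcoset (repr D)^-1%g))).

Definition hecke_char (R : realType) (x : G) : hecke_algebra R :=
  pointmass R (dcoset x).

Definition hecke_rep (R : realType) (K : hilbert R)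
    (V : hecke_algebra R -> K -> K) : Prop :=
  star_rep V /\ forall v, V (hecke_char R 1%g) v = v.

Definition covariant_pair (R : realType) (K : hilbert R)
    (nu : c0 R lcosets -> K -> K) (V : hecke_algebra R -> K -> K) : Prop :=
  forall (a x b : G) (k : K),
    V (hecke_char R a) (nu (pointmass R (lcoset x)) (V (hecke_char R b) k)) =
    \sum_(u \in lcosets_in (dcoset a^-1%g)) \sum_(v \in lcosets_in (dcoset b))
      nu (pointmass R (lcoset_act x u))
        (V (hecke_char R ((repr u)^-1 * repr v)%g)
          (nu (pointmass R (lcoset_act x v)) k)).

End Cosets.

Arguments hecke_char {G} H R x.

(* In this section A, with u, stands for C*(G), and T, with t, for B (x) A. *)
Section Coactions.
Variables (R : realType) (G : groupType) (A B T : cstar_algebra R).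
Variables (u : G -> A) (t : B -> A -> T).

(* The last clause is the coaction identity, in T3 = (B (x) A) (x) A: there
   delta_id is delta (x) id, and id_deltaG is id (x) delta_G, where delta_G is
   the comultiplication u x |-> u x (x) u x of C*(G). *)
Definition coaction (delta : B -> T) : Prop :=
  [/\ star_hom (delta : cstar_alg B -> T),
      injective delta,
      dense (lspan [set z | exists b y, z = cmul (delta b) y])
    & exists (T3 : cstar_algebra R) (t3 : T -> A -> T3)
        (delta_id id_deltaG : cstar_alg T -> T3),
        [/\ min_tensor t3,
            star_hom delta_id /\
            (forall b a, delta_id (t b a) = t3 (delta b) a),
            star_hom id_deltaG /\
            (forall b x, id_deltaG (t b (u x)) = t3 (t b (u x)) (u x))
          & forall b, delta_id (delta b) = id_deltaG (delta b)]].

Variable delta : B -> T.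

Definition spectral (x : G) : set B := [set b | delta b = t b (u x)].

(* Gamma_c of the Fell bundle of spectral subspaces: the external direct sum *)
Definition sections : star_algebra R :=
  @StarAlgebra R (G -> B)
    [set f | (forall x, spectral x (f x)) /\ finite_set [set x | f x <> 0]]
    (fun f g x => \sum_(y \in [set: G]) cmul (f y) (g (y^-1 * x)%g))
    (fun f x => cstar (f x^-1%g)).

(* The canonical map of Gamma_c of the bundle into B identifies B with the
   C*-algebra of the bundle. *)
Definition maximal : Prop :=
  enveloping (fun f : sections => \sum_(x \in [set: G]) f x).

Variable H : groupClosed G.

(* Gamma_c of the Fell bundle over the transformation groupoid G x G/H, whose
   element (x, yH) has source yH and range xyH *)
Definition gsections : star_algebra R :=
  @StarAlgebra R (G * lcosets H -> B)
    [set f | (forall p, spectral p.1 (f p)) /\ finite_set [set p | f p <> 0]]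
    (fun f g p => \sum_(z \in [set: G])
       cmul (f ((p.1 * z^-1)%g, lcoset_act z p.2)) (g (z, p.2)))
    (fun f p => cstar (f (p.1^-1%g, lcoset_act p.1 p.2))).

(* (b, yH), for b in the fiber over x *)
Definition generator (b : B) (x : G) (y : lcosets H) : gsections :=
  fun p => if p == (x, y) then b else 0.

(* X, with iota, is the Echterhoff-Quigg crossed product of B by G/H. *)
Definition crossed_product (X : cstar_algebra R) (iota : gsections -> X) :
  Prop := enveloping iota.

Definition covariant_rep (K : hilbert R) (pi : cstar_alg B -> K -> K)
    (nu : c0 R (lcosets H) -> K -> K) : Prop :=
  [/\ representation pi, representation nu
    & forall x y b v, spectral x b ->
        pi b (nu (pointmass R y) v) =
        nu (pointmass R (lcoset_act x y)) (pi b v)].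

Section IntegratedForms.
Variables (X : cstar_algebra R) (iota : gsections -> X).

Definition integrated_form (K : hilbert R) (pi : cstar_alg B -> K -> K)
    (nu : c0 R (lcosets H) -> K -> K) (Phi : cstar_alg X -> K -> K) : Prop :=
  representation Phi /\
  forall x y b v, spectral x b ->
    Phi (iota (generator b x y)) v = pi b (nu (pointmass R y) v).

Variables (L : hilbert R) (e : lcosets H -> L).

(* Phi, on the tensor product (S, s) of K and L = l^2(G/H), is the regular
   representation induced by theta: lambda is the integrated form of the
   quasi-regular representation, Theta is theta (x) lambda, M the
   multiplication representation and oneM is 1 (x) M. *)
Definition regular_induced (K : hilbert R) (theta : cstar_alg B -> K -> K)
    (S : hilbert R) (s : K -> L -> S) (Phi : cstar_alg X -> S -> S) : Prop :=
  exists (lambda : cstar_alg A -> L -> L) (Theta : cstar_alg T -> S -> S)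
    (M : c0 R (lcosets H) -> L -> L) (oneM : c0 R (lcosets H) -> S -> S),
    [/\ representation lambda /\
        (forall x y, lambda (u x) (e y) = e (lcoset_act x y)),
        representation Theta /\
        (forall b a v w, Theta (t b a) (s v w) = s (theta b v) (lambda a w)),
        representation M /\
        (forall f y, carrier (c0 R (lcosets H)) f -> M f (e y) = f y *: e y),
        representation oneM /\
        (forall f v w, carrier (c0 R (lcosets H)) f ->
           oneM f (s v w) = s v (M f w))
      & integrated_form (fun b => Theta (delta b)) oneM Phi].

Definition regular (S : hilbert R) (Phi : cstar_alg X -> S -> S) : Prop :=
  exists (K : hilbert R) (theta : cstar_alg B -> K -> K) (s : K -> L -> S),
    [/\ representation theta, hilbert_tensor s & regular_induced theta s Phi].

End IntegratedForms.

End Coactions.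

(* Main.v *)
Require Import Defs.
From HB Require Import structures.
From mathcomp Require Import all_boot all_order all_algebra.
From mathcomp Require Import sesquilinear complex.
From mathcomp Require Import all_classical all_reals all_analysis.
From mathcomp Require Import ring.
Import numFieldNormedType.Exports.
Import Order.TTheory GRing.Theory Num.Theory.

(** A covariant pair [(nu, V)] yields matrix units
    [E_{xH,yH} = nu(eps_{xH}) V([H x^-1 y H]) nu(eps_{yH})] indexed by [G/H]:
    the covariance relation gives [E_{x,y} E_{y,z} = E_{x,z}] and
    [E_{x,x} = nu(eps_x)], and the diagonal sums to 1.  Hence [K] is
    [K0 (x) l^2(G/H)] with [K0 = nu(eps_H) K], in such a way that [nu] becomes
    [1 (x) M].  If moreover [V] commutes with [pi], then
    [pi(b) E_{y,z} = E_{xy,xz} pi(b)] for [b] in the spectral subspace of [x],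
    so that [b |-> E_{H,xH} pi(b)] is a representation on [K0] of the sections
    of the Fell bundle; by maximality it extends to a representation [theta] of
    [B], which induces [pi x nu].

    Conversely, on [K_theta (x) l^2(G/H)] the Hecke algebra acts by
    [1 (x) rho], with [rho(f) eps_y = sum_x f(H x^-1 y H) eps_x] (bounded by a
    Schur test).  As [rho] commutes with the quasi-regular representation of
    [G], it commutes with the spectral subspaces, hence with [B]. *)

Set Implicit Arguments.
Unset Strict Implicit.
Unset Printing Implicit Defensive.

Local Open Scope classical_set_scope.
Local Open Scope ring_scope.

(** * Linear spans and bounded operators *)

(** A function on double cosets is a [G]-invariant matrix over [G/H], and the convolution of the
    Hecke algebra is the matrix product. Both directions rest on this: invariance makes the matrices
    commute with translations, and the covariance relation, compressed by two point masses, keeps a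
    single term of its double sum.

    Three analytic obstacles shape the rest. A unitary equivalence is given for integrated forms
    only, and must be shown to intertwine [pi] and [nu] separately; this uses that finite sums of
    point masses tend strongly to 1 and that [pi] is nondegenerate. Passing from spectral subspaces
    to [B] needs continuity of [b |-> pi b v], while a representation is assumed bounded operator by
    operator; hence the square roots in a C*-algebra. Finally, [theta (x) lambda] has to be produced
    on [T] from the norm formula of the minimal tensor product, since [T] is known only through its
    properties. *)

Section LinearSpan.
Variables (F : numFieldType) (V : lmodType F).
Implicit Types S P : set V.

Definition linear_set P := P 0 /\ forall a x y, P x -> P y -> P (a *: x + y).

Lemma linear_set_sum P I (r : seq I) (f : I -> V) :
  linear_set P -> (forall i, P (f i)) -> P (\sum_(i <- r) f i).
Proof.
move=> [P0 PZD] Pf; elim: r => [|i r IHr]; first by rewrite big_nil.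
by rewrite big_cons -[f i]scale1r; apply: PZD.
Qed.

Lemma lspan_linear S : linear_set (lspan S).
Proof.
split; first by exists 0%N, (fun=> 0), (fun=> 0); split=> [[]//|];
  rewrite big_ord0.
move=> a x y [n [c [w [Sw ->]]]] [m [d [z [Sz ->]]]].
exists (n + m)%N, (fun i => match fintype.split i with inl j =>
  a * c j | inr k => d k end),
  (fun i => match fintype.split i with inl j => w j | inr k => z k end).
split=> [i|]; first by case: fintype.split.
rewrite big_split_ord /= scaler_sumr; congr (_ + _); apply: eq_bigr => i _.
  by rewrite (unsplitK (inl i)) scalerA.
by rewrite (unsplitK (inr i)).
Qed.

Lemma sub_lspan S : S `<=` lspan S.
Proof.
by move=> v Sv; exists 1%N, (fun=> 1), (fun=> v); rewrite big_ord1 scale1r.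
Qed.

Lemma lspan_min S P : linear_set P -> S `<=` P -> lspan S `<=` P.
Proof.
move=> PL SP v [n [c [w [Sw ->]]]]; apply: linear_set_sum => // i.
by rewrite -[_ *: _]addr0; apply: PL.2; [exact/SP/Sw | exact: PL.1].
Qed.

End LinearSpan.

Section LinearProp.
Variables (F : numFieldType) (V W : lmodType F) (f : V -> W).
Hypothesis f_lin : linear f.

Lemma linear_prop0 : f 0 = 0.
Proof. by have := f_lin (-1) 0 0; rewrite scaler0 addr0 scaleN1r addNr. Qed.

Lemma linear_propD : {morph f : x y / x + y}.
Proof. by move=> x y; have := f_lin 1 x y; rewrite !scale1r. Qed.

Lemma linear_propZ a : {morph f : x / a *: x}.
Proof. by move=> x; have := f_lin a x 0; rewrite !addr0 linear_prop0 addr0. Qed.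

Lemma linear_propN : {morph f : x / - x}.
Proof. by move=> x; rewrite -scaleN1r linear_propZ scaleN1r. Qed.

Lemma linear_propB : {morph f : x y / x - y}.
Proof. by move=> x y; rewrite linear_propD linear_propN. Qed.

Lemma linear_prop_sum I (r : seq I) P (g : I -> V) :
  f (\sum_(i <- r | P i) g i) = \sum_(i <- r | P i) f (g i).
Proof. exact: (big_morph f linear_propD linear_prop0). Qed.

Lemma linear_prop_fsum (I : choiceType) (D : set I) (g : I -> V) :
  finite_set D -> f (\sum_(i \in D) g i) = \sum_(i \in D) f (g i).
Proof. by move=> finD; rewrite !fsbig_finite// linear_prop_sum. Qed.

End LinearProp.

(** * Closed linear spans and operators determined on a total set *)

Section NormedDensity.
Variable F : numFieldType.
Implicit Types V W X : normedModType F.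

Lemma denseP V (S : set V) :
  dense S <-> forall v (e : F), 0 < e -> exists2 w, S w & `|v - w| < e.
Proof.
split=> [dS v e e0|dS O [v Ov] oO].
  have := dS (ball v e) (ex_intro _ v (ballxx v e0)) (ball_open v e).
  by move=> [w []]; rewrite -ball_normE /=; exists w.
have /nbhs_ballP[e /= e0 eO] : nbhs v O by apply: open_nbhs_nbhs; split.
have [w Sw vw] := dS v e e0; exists w; split=> //; apply: eO.
by rewrite -ball_normE.
Qed.

Definition closed_set V (P : set V) :=
  forall v, (forall e : F, 0 < e -> exists2 w, P w & `|v - w| < e) -> P v.

(** Serves as an induction principle: most identities below between bounded operators are checked on
    generators only, through [bounded_eq_total], where [P] is the closed subspace on which the two
    operators agree. *)
Lemma dense_lspan_min V (S P : set V) : dense (lspan S) ->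
  linear_set P -> closed_set P -> S `<=` P -> forall v, P v.
Proof.
move=> /denseP dS PL Pcl SP v; apply: Pcl => e /(dS v)[w Sw vw].
by exists w => //; apply: lspan_min Sw.
Qed.

Lemma norm_axpy_lt V (a e : F) (x y : V) :
  `|x| < e / 2 / (`|a| + 1) -> `|y| < e / 2 -> `|a *: x + y| < e.
Proof.
have a10 : 0 < `|a| + 1 by rewrite ltr_wpDl.
move=> xe ye; have e20 : 0 < e / 2 by apply: le_lt_trans ye.
rewrite [e]splitr; apply: le_lt_trans (ler_normD _ _) _.
rewrite normrZ; apply: ler_ltD => //.
apply: le_trans (ler_wpM2l (normr_ge0 a) (ltW xe)) _.
rewrite mulrCA -[leRHS]mulr1 ler_wpM2l ?(ltW e20)//.
by rewrite ler_pdivrMr ?mul1r ?lerDl.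
Qed.

Definition closure_span V (S : set V) : set V :=
  [set v | forall e : F, 0 < e -> exists2 w, lspan S w & `|v - w| < e].

Lemma closure_span_linear V (S : set V) : linear_set (closure_span S).
Proof.
split=> [e e0|a x y Sx Sy e e0].
  by exists 0; [exact: (lspan_linear S).1 | rewrite subrr normr0].
have d0 : 0 < e / 2 / (`|a| + 1).
  by rewrite !divr_gt0// ltr_wpDl.
have [x' Sx' xx'] := Sx _ d0; have [y' Sy' yy'] :=
  Sy _ (divr_gt0 e0 (ltr0Sn _ 1)).
exists (a *: x' + y'); first exact: (lspan_linear S).2.
by rewrite opprD addrACA -scalerBr; apply: norm_axpy_lt.
Qed.

Lemma closure_span_closed V (S : set V) : closed_set (closure_span S).
Proof.
move=> v Sv e e0; have e20 : 0 < e / 2 by rewrite divr_gt0.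
have [w Sw vw] := Sv _ e20; have [x Sx wx] := Sw _ e20.
exists x => //; rewrite [e]splitr -(subrKA w).
by apply: le_lt_trans (ler_normD _ _) _; apply: ltrD.
Qed.

Lemma sub_closure_span V (S : set V) : S `<=` closure_span S.
Proof.
by move=> v /sub_lspan Sv e e0; exists v => //; rewrite subrr normr0.
Qed.

Lemma dense_lspan_trans V (S S' : set V) : dense (lspan S) ->
  S `<=` closure_span S' -> dense (lspan S').
Proof.
move=> dS SS'; apply/denseP; apply: (dense_lspan_min dS) => //.
- exact: closure_span_linear.
- exact: closure_span_closed.
Qed.

Lemma bounded_operatorP V W (T : V -> W) : bounded_operator T <->
  linear T /\ exists2 M, 0 < M & forall v, `|T v| <= M * `|v|.
Proof.
split=> [[Tlin [M TM]]|[Tlin [M _ TM]]]; last by split=> //; exists M.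
(* The given [M] may be negative or not real when [V] is zero; [|M| + 1] is positive in all
   cases. *)
split=> //; exists (`|M| + 1) => [|v]; first by rewrite ltr_wpDl.
have [->|v0] := eqVneq v 0; first by rewrite linear_prop0// !normr0 mulr0.
apply: le_trans (TM v) _; rewrite ler_wpM2r//.
have M0 : 0 <= M.
  by rewrite -(pmulr_lge0 _ (_ : 0 < `|v|)) ?normr_gt0// (le_trans _ (TM v)).
by rewrite ger0_norm// lerDl.
Qed.

Lemma bounded_id V : bounded_operator (@id V).
Proof. by split=> //; exists 1 => v; rewrite mul1r. Qed.

Lemma bounded_comp V W X (T : W -> X) (U : V -> W) :
  bounded_operator T -> bounded_operator U -> bounded_operator (T \o U).
Proof.
move=> /bounded_operatorP[Tlin [M M0 TM]] /bounded_operatorP[Ulin [N N0 UN]].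
split=> [a x y|]; first by rewrite /= Ulin Tlin.
exists (M * N) => v /=; apply: le_trans (TM _) _.
by rewrite -mulrA ler_wpM2l// ltW.
Qed.

Lemma bounded_zero V W : bounded_operator ((fun=> 0) : V -> W).
Proof.
split=> [a x y|]; first by rewrite scaler0 addr0.
by exists 0 => v; rewrite normr0 mul0r.
Qed.

Lemma bounded_axpy V W (T U : V -> W) a : bounded_operator T ->
  bounded_operator U -> bounded_operator (fun v => a *: T v + U v).
Proof.
move=> [Tlin [M TM]] [Ulin [N UN]]; split=> [b x y|].
  by rewrite Tlin Ulin !scalerDr !scalerA addrACA mulrC.
exists (`|a| * M + N) => v; rewrite mulrDl; apply: le_trans (ler_normD _ _) _.
by rewrite lerD// normrZ -mulrA ler_wpM2l.
Qed.

Lemma bounded_sum V W I (r : seq I) (T : I -> V -> W) :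
  (forall i, bounded_operator (T i)) ->
  bounded_operator (fun v => \sum_(i <- r) T i v).
Proof.
move=> Tb; elim: r => [|i r IHr].
  by under eq_fun do rewrite big_nil; apply: bounded_zero.
under eq_fun do rewrite big_cons -[T _ _]scale1r.
exact: bounded_axpy.
Qed.

Lemma norm_le_small V (v : V) :
  (forall e : F, 0 < e -> `|v| <= e) -> v = 0.
Proof.
move=> v_small; apply/eqP/negPn/negP; rewrite -normr_gt0 => v0.
have := v_small _ (divr_gt0 v0 (ltr0Sn _ 1)).
by rewrite ler_pdivlMr// mulr_natr mulr2n gerDl (lt_geF v0).
Qed.

Lemma bounded_closed_eq V W (T U : V -> W) : bounded_operator T ->
  bounded_operator U ->
  linear_set [set v | T v = U v] /\ closed_set [set v | T v = U v].
Proof.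
move=> Tb Ub; split.
  split=> [|a x y /= Txy Uxy];
    first by rewrite /= (linear_prop0 Tb.1) (linear_prop0 Ub.1).
  by rewrite Tb.1 Ub.1 Txy Uxy.
have /bounded_operatorP[Dlin [M M0 DM]] := bounded_axpy (-1) Tb Ub.
move=> v Tv /=; apply/esym/eqP; rewrite -subr_eq0 addrC -scaleN1r.
apply/eqP/norm_le_small => e e0; have [w Tw vw] := Tv _ (divr_gt0 e0 M0).
have -> : -1 *: T v + U v = -1 *: T (v - w) + U (v - w).
  rewrite (linear_propB Tb.1) (linear_propB Ub.1) Tw scalerBr !scaleN1r.
  by rewrite opprK addrACA subrr addr0.
by rewrite (le_trans (DM _))// -ler_pdivlMl// mulrC ltW.
Qed.

Lemma bounded_eq_total V W (S : set V) (T U : V -> W) : dense (lspan S) ->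
  bounded_operator T -> bounded_operator U ->
  (forall v, S v -> T v = U v) -> T =1 U.
Proof.
move=> dS Tb Ub TU v; have [lin clo] := bounded_closed_eq Tb Ub.
exact: (dense_lspan_min dS lin clo).
Qed.

End NormedDensity.

(** * Extension of bounded operators *)

Section Extension.
Variables (F : numFieldType).

(** The order of [F] is partial; a minimum is available because positive elements are real. *)
Lemma common_lower_bound (a b : F) : 0 < a -> 0 < b ->
  exists c : F, [/\ 0 < c, c <= a & c <= b].
Proof.
move=> a0 b0; case: (real_leP (gtr0_real a0) (gtr0_real b0)) => ab.
  by exists a; split.
by exists b; split=> //; apply: ltW.
Qed.

(** [Gr] is a relation because it is not known beforehand that the values are well defined: the
    bound, applied to differences, makes it single-valued. Its closure satisfies the same bound, and
    completeness of [W] makes that closure total. *)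
Lemma bounded_extension (V : normedModType F) (W : completeNormedModType F)
    (Gr : V -> W -> Prop) (M : F) : 0 < M ->
    Gr 0 0 ->
    (forall a x y x' y', Gr x x' -> Gr y y' -> Gr (a *: x + y) (a *: x' + y'))
      ->
    (forall x x', Gr x x' -> `|x'| <= M * `|x|) ->
    dense [set x | exists x', Gr x x'] ->
  exists T : V -> W, [/\ linear T, forall v, `|T v| <= M * `|v|
    & forall x x', Gr x x' -> T x = x'].
Proof.
move=> M0 Gr0 GrZD GrM /denseP Gr_dense.
have GrB x y x' y' : Gr x x' -> Gr y y' -> Gr (x - y) (x' - y').
  move=> xx' yy'; rewrite addrC (addrC x') -scaleN1r -[- y']scaleN1r.
  exact: GrZD.
pose cl x x' := forall e : F, 0 < e ->
  exists y y', [/\ Gr y y', `|x - y| < e & `|x' - y'| < e].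
have cl_bound x x' : cl x x' -> `|x'| <= M * `|x|.
  move=> xx'; rewrite -subr_le0; apply/negPn/negP => x'_gt.
  have x'_real : `|x'| - M * `|x| \is Num.real.
    by rewrite rpredB ?rpredM ?normr_real// gtr0_real.
  have {x'_gt}x'_gt : 0 < `|x'| - M * `|x| by rewrite real_ltNge// real0.
  have M10 : 0 < M + 1 by rewrite addr_gt0.
  (* With the gap divided by [M + 1] as tolerance [d], the estimate [M (|x| + d) + d] equals [|x'|]
     exactly, which contradicts the strict inequality. *)
  have [y [y' [yy' xy x'y']]] := xx' _ (divr_gt0 x'_gt M10).
  move: xy x'y'; set d := _ / _ => xy x'y'.
  have : `|x'| < M * (`|x| + d) + d.
    rewrite -(subrK y' x') addrC; apply: le_lt_trans (ler_normD _ _) _.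
    apply: ler_ltD => //; apply: le_trans (GrM _ _ yy') _.
    rewrite ler_wpM2l ?(ltW M0)//; have -> : y = x - (x - y)
      by rewrite opprB addrC subrK.
    by apply: le_trans (ler_normB _ _) _; rewrite lerD2l ltW.
  have -> : M * (`|x| + d) + d = M * `|x| + d * (M + 1).
    by rewrite !mulrDr mulr1 addrA (mulrC d).
  by rewrite divfK ?lt0r_neq0// addrC subrK ltxx.
have clZD a x y x' y' : cl x x' -> cl y y' -> cl (a *: x + y) (a *: x' + y').
  move=> xx' yy' e e0.
  have a10 : 0 < `|a| + 1 by rewrite ltr_wpDl.
  have [u [u' [uu' xu xu']]] := xx' _ (divr_gt0 (divr_gt0 e0 (ltr0Sn _ 1)) a10).
  have [v [v' [vv' yv yv']]] := yy' _ (divr_gt0 e0 (ltr0Sn _ 1)).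
  exists (a *: u + v), (a *: u' + v').
  have near_lin (Z : normedModType F) (p q r s : Z) :
      `|p - r| < e / 2 / (`|a| + 1) -> `|q - s| < e / 2 ->
      `|a *: p + q - (a *: r + s)| < e.
    by move=> pr qs; rewrite opprD addrACA -scalerBr; apply: norm_axpy_lt.
  by split; [exact: GrZD | exact: near_lin | exact: near_lin].
have cl_total x : exists x', cl x x'.
  (* The value at [x] is the limit of the images of points of the domain that approach [x]. *)
  pose B (e : F) : set W := [set y' | exists2 y, Gr y y' & `|x - y| < e].
  pose FB := filter_from [set e : F | 0 < e] B.
  have B_mono d e : d <= e -> B d `<=` B e.
    by move=> de y' [y yy' xy]; exists y => //; apply: lt_le_trans de.
  have FB_filter : Filter FB.
    apply: filter_from_filter => [|d e /= d0 e0]; first by exists 1 => /=.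
    have [c [c0 cd ce]] := common_lower_bound d0 e0.
    by exists c => // y' By'; split; apply: B_mono By'.
  have FB_proper : ProperFilter FB.
    apply: filter_from_proper => e /= e0.
    by have [y [y' yy'] xy] := Gr_dense x _ e0; exists y', y.
  have FB_cauchy : cauchy FB.
    apply: cauchy_exP => e e0.
    have d0 : 0 < e / 2 / M by rewrite !divr_gt0.
    have [y [y' yy'] xy] := Gr_dense x _ d0.
    exists y', (e / 2 / M) => // z' [z zz' xz]; rewrite -ball_normE /=.
    apply: le_lt_trans (GrM _ _ (GrB _ _ _ _ yy' zz')) _.
    rewrite mulrC -ltr_pdivlMr// [e]splitr mulrDl -(subrKA x).
    apply: le_lt_trans (ler_normD _ _) _.
    by rewrite distrC ltrD.
  have FB_cvg : cvg FB by apply: cauchy_cvg.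
  exists (lim FB) => e e0.
  have /nbhs_ballP FB_near : nbhs (lim FB) (ball (lim FB) e).
    by apply/nbhs_ballP; exists e.
  have [d d0 Bd] : FB (ball (lim FB) e) by apply: FB_cvg; apply/nbhs_ballP.
  have [c [c0 cd ce]] := common_lower_bound d0 e0.
  have [y [y' yy'] xy] := Gr_dense x _ c0.
  exists y, y'; split=> //; first exact: lt_le_trans ce.
  have /Bd : B d y' by exists y => //; apply: lt_le_trans cd.
  by rewrite -ball_normE.
have cl_unique x y z : cl x y -> cl x z -> y = z.
  move=> xy xz; have := clZD (-1) _ _ _ _ xz xy; rewrite !scaleN1r addNr.
  move=> /cl_bound; rewrite normr0 mulr0 normr_le0 addrC subr_eq0.
  by move/eqP.
have cl_Gr x x' : Gr x x' -> cl x x'.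
  by move=> xx' e e0; exists x, x'; rewrite !subrr !normr0.
exists (fun x => projT1 (cid (cl_total x))).
split=> [a x y|v|x x' xx'].
- apply: cl_unique (projT2 (cid (cl_total _))) _.
  by apply: clZD; apply: (projT2 (cid (cl_total _))).
- exact/cl_bound/(projT2 (cid (cl_total v))).
- by apply: cl_unique (projT2 (cid (cl_total _))) _; apply: cl_Gr.
Qed.

(** The inequality on combinations contains well-definedness: every linear relation among the [g j]
    is forced on the [g' j]. *)
Lemma bounded_extension_family (V : normedModType F)
    (W : completeNormedModType F) (J : Type) (g : J -> V) (g' : J -> W) (M :
      F) :
    0 < M ->
    (forall n (c : 'I_n -> F) (j : 'I_n -> J),
      `|\sum_i c i *: g' (j i)| <= M * `|\sum_i c i *: g (j i)|) ->
    dense (lspan (range g)) ->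
  exists T : V -> W, [/\ linear T, forall v, `|T v| <= M * `|v|
    & forall j, T (g j) = g' j].
Proof.
move=> M0 gM g_dense.
pose Gr v w := exists n (c : 'I_n -> F) (j : 'I_n -> J),
  v = \sum_i c i *: g (j i) /\ w = \sum_i c i *: g' (j i).
have [] := @bounded_extension V W Gr M M0.
- by exists 0%N, (fun=> 0), (fun i : 'I_0 => False_rect J (notF (ltn_ord i)));
  rewrite !big_ord0.
- move=> a x y x' y' [n [c [j [-> ->]]]] [m [d [k [-> ->]]]].
  exists (n + m)%N,
    (fun i => match fintype.split i with inl l => a * c l | inr l => d l end),
    (fun i => match fintype.split i with inl l => j l | inr l => k l end).
  rewrite !big_split_ord /= !scaler_sumr.
  split; congr (_ + _); apply: eq_bigr => i _;
    by rewrite ?(unsplitK (inl i)) ?(unsplitK (inr i)) ?scalerA.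
- by move=> x x' [n [c [j [-> ->]]]].
- apply/denseP => v e e0; have /denseP/(_ v e e0) := g_dense.
  move=> [w [n [c [z [gz ->]]]] vw]; exists (\sum_i c i *: z i) => //.
  pose j i := projT1 (cid2 (gz i)).
  exists (\sum_i c i *: g' (j i)), n, c, j; split=> //.
  by apply: eq_bigr => i _; rewrite /j; case: cid2 => ? _ /= ->.
- move=> T [Tlin TM Tg]; exists T; split=> // j; apply: Tg.
  by exists 1%N, (fun=> 1), (fun=> j); rewrite !big_ord1 !scale1r.
Qed.

End Extension.

(** * Hilbert spaces *)

Section InnerProduct.
Variable R : realType.
Local Notation C := R[i].
Implicit Types K L M N : hilbert R.

Lemma innerPl K (a : C) (v w z : K) :
  inner (a *: v + w) z = a * inner v z + inner w z.
Proof. by rewrite linearPl. Qed.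

Lemma innerPr K (a : C) (v w z : K) :
  inner z (a *: v + w) = Num.conj a * inner z v + inner z w.
Proof. by rewrite linearPr. Qed.

Lemma inner0l K (z : K) : inner 0 z = 0.
Proof. by rewrite linear0l. Qed.

Lemma inner0r K (z : K) : inner z 0 = 0.
Proof. by rewrite linear0r. Qed.

Lemma innerDl K (v w z : K) : inner (v + w) z = inner v z + inner w z.
Proof. by rewrite linearDl. Qed.

Lemma innerDr K (v w z : K) : inner z (v + w) = inner z v + inner z w.
Proof. by rewrite linearDr. Qed.

Lemma innerBl K (v w z : K) : inner (v - w) z = inner v z - inner w z.
Proof. by rewrite linearBl. Qed.

Lemma innerBr K (v w z : K) : inner z (v - w) = inner z v - inner z w.
Proof. by rewrite linearBr. Qed.

Lemma innerZl K (a : C) (v z : K) : inner (a *: v) z = a * inner v z.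
Proof. by rewrite linearZl_LR. Qed.

Lemma innerZr K (a : C) (v z : K) : inner z (a *: v) = Num.conj a * inner z v.
Proof. by rewrite linearZr_LR. Qed.

Lemma inner_conj K (v w : K) : inner v w = Num.conj (inner w v).
Proof. by rewrite hermC expr0 mul1r. Qed.

Lemma inner_suml K I (r : seq I) P (f : I -> K) (z : K) :
  inner (\sum_(i <- r | P i) f i) z = \sum_(i <- r | P i) inner (f i) z.
Proof.
exact: (big_morph (fun v => inner v z) (fun v w => innerDl v w z) (inner0l z)).
Qed.

Lemma inner_sumr K I (r : seq I) P (f : I -> K) (z : K) :
  inner z (\sum_(i <- r | P i) f i) = \sum_(i <- r | P i) inner z (f i).
Proof.
exact: (big_morph (fun v => inner z v) (fun v w => innerDr v w z) (inner0r z)).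
Qed.

Lemma inner_eq0 K (v : K) : inner v v = 0 -> v = 0.
Proof.
by rewrite -inner_norm => /eqP; rewrite expf_eq0 /= normr_eq0 => /eqP.
Qed.

Lemma cauchy_schwarz K (v w : K) : `|inner v w| <= `|v| * `|w|.
Proof.
have [->|w0] := eqVneq w 0; first by rewrite inner0r !normr0 mulr0.
have n0 : 0 < `|w| ^+ 2 by rewrite exprn_gt0// normr_gt0.
have nR : Num.conj (`|w| ^+ 2) = `|w| ^+ 2 by rewrite conj_Creal// gtr0_real.
rewrite -(@ler_pXn2r _ 2) ?nnegrE ?mulr_ge0// exprMn -subr_ge0.
rewrite -(pmulr_rge0 _ n0).
(* Expanded, this is [|w|^2 (|v|^2 |w|^2 - |<v,w>|^2)]: the usual projection argument, multiplied by
   [|w|^2] to avoid a division. *)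
have : 0 <= inner (`|w| ^+ 2 *: v - inner v w *: w)
               (`|w| ^+ 2 *: v - inner v w *: w).
  by rewrite -inner_norm exprn_ge0.
rewrite innerBl !innerBr !innerZl !innerZr nR -!inner_norm (inner_conj w v).
rewrite normCK; set a := inner v w; set n := `|w| ^+ 2; set m := `|v| ^+ 2.
by congr (0 <= _); ring.
Qed.

Lemma inner_bounded K (v : K) : bounded_operator (fun w => inner w v : C^o).
Proof.
split=> [a x y|]; first by rewrite innerPl.
by exists `|v| => w; rewrite mulrC cauchy_schwarz.
Qed.

(** One variable is treated at a time; conjugation turns the antilinear second variable into a
    linear one. *)
Lemma form_total K L M N (S : set K) (S' : set L)
    (T : K -> M) (U : L -> M) (T' : K -> N) (U' : L -> N) :
    bounded_operator T -> bounded_operator U ->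
    bounded_operator T' -> bounded_operator U' ->
    dense (lspan S) -> dense (lspan S') ->
    (forall v w, S v -> S' w -> inner (T v) (U w) = inner (T' v) (U' w)) ->
  forall v w, inner (T v) (U w) = inner (T' v) (U' w).
Proof.
move=> Tb Ub Tb' Ub' dS dS' eqSS'.
have eqS v w : S v -> inner (T v) (U w) = inner (T' v) (U' w).
  move=> Sv; rewrite inner_conj [RHS]inner_conj; congr Num.conj.
  apply: (bounded_eq_total dS'
    (bounded_comp (inner_bounded (T v)) Ub)
    (bounded_comp (inner_bounded (T' v)) Ub')) => z Sz /=.
  by rewrite inner_conj eqSS'// -inner_conj.
move=> v w; apply: (bounded_eq_total dS
  (bounded_comp (inner_bounded (U w)) Tb)
  (bounded_comp (inner_bounded (U' w)) Tb')) => z Sz /=.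
exact: eqS.
Qed.

Lemma adjoint_total K L (S : set K) (S' : set L) (T : K -> L) (T' : L -> K) :
    bounded_operator T -> bounded_operator T' ->
    dense (lspan S) -> dense (lspan S') ->
    (forall v w, S v -> S' w -> inner (T v) w = inner v (T' w)) ->
  forall v w, inner (T v) w = inner v (T' w).
Proof.
move=> Tb Tb' dS dS' adj.
exact: (form_total Tb (@bounded_id _ L) (@bounded_id _ K) Tb' dS dS' adj).
Qed.

Lemma inner_total K (S : set K) (v w : K) : dense (lspan S) ->
  (forall z, S z -> inner v z = inner w z) -> v = w.
Proof.
move=> dS vw; apply/eqP; rewrite -subr_eq0; apply/eqP/inner_eq0.
have /(bounded_eq_total dS (inner_bounded v) (inner_bounded w)) vw' :
    forall z, S z -> inner z v = inner z w :> C^o.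
  by move=> z Sz; rewrite inner_conj vw// -inner_conj.
by rewrite innerBr; apply/eqP; rewrite subr_eq0; apply/eqP/vw'.
Qed.

(** Gram matrices determine the norms of linear combinations. The factor [r] is there for
    [corner_tensor], where [w |-> s v w] multiplies inner products by [|v|^2]. *)
Lemma gram_extension K L (J : Type) (g : J -> K) (g' : J -> L) (r : C) :
    0 <= r ->
    (forall i j, inner (g' i) (g' j) = r * inner (g i) (g j)) ->
    dense (lspan (range g)) ->
  exists T : K -> L, [/\ bounded_operator T,
    forall v w, inner (T v) (T w) = r * inner v w & forall j, T (g j) = g' j].
Proof.
(* [r + 1] is a positive bound that avoids square roots, as [r <= (r + 1)^2]. *)
move=> r0 gram dg; have r10 : 0 < r + 1 by rewrite ltr_wpDl.
have [n c j|T [Tlin TM Tg]] := bounded_extension_family r10 _ dg (g' := g').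
  rewrite -(@ler_pXn2r _ 2) ?nnegrE ?mulr_ge0 ?(ltW r10)// exprMn.
  suff -> : `|\sum_i c i *: g' (j i)| ^+ 2 = r * `|\sum_i c i *: g (j i)| ^+ 2.
    rewrite ler_wpM2r ?exprn_ge0// expr2 mulrDr mulr1 -subr_ge0.
    have -> : (r + 1) * r + (r + 1) - r = r * r + r + 1 by ring.
    by rewrite !addr_ge0// mulr_ge0.
  rewrite !inner_norm !inner_suml mulr_sumr; apply: eq_bigr => k _.
  rewrite !inner_sumr mulr_sumr; apply: eq_bigr => l _.
  by rewrite !innerZl !innerZr gram; ring.
have Tb : bounded_operator T by split=> //; exists (r + 1).
exists T; split=> // v w; rewrite -innerZl.
have rb : bounded_operator (fun v : K => r *: v).
  split=> [a x y|]; first by rewrite scalerDr !scalerA mulrC.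
  by exists `|r| => x; rewrite normrZ.
apply: (form_total Tb Tb rb (@bounded_id _ K) dg dg) => _ _ [i _ <-] [k _ <-].
by rewrite !Tg gram innerZl.
Qed.

End InnerProduct.

(** * The fixed space of a bounded operator as a Hilbert space *)

Section FixedSpace.
Variables (R : realType) (K : hilbert R) (p : K -> K).
Hypothesis p_bounded : bounded_operator p.
Local Notation C := R[i].

(** The proof of boundedness is a parameter so that the structures declared below can be recovered
    from the predicate alone. *)
Definition fixed_by of bounded_operator p : {pred K} := fun v => p v == v.

Local Notation fixed := (fixed_by p_bounded).

Fact fixed_by_submod : submod_closed fixed.
Proof.
split=> [|a x y /eqP px /eqP py]; first exact/eqP/(linear_prop0 p_bounded.1).
by apply/eqP; rewrite p_bounded.1 px py.
Qed.

HB.instance Definition _ := GRing.isSubmodClosed.Build C K fixed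
  fixed_by_submod.

Definition fixed_space := {v | v \in fixed}.
HB.instance Definition _ := Choice.on fixed_space.
HB.instance Definition _ := SubChoice.on fixed_space.
HB.instance Definition _ := [SubChoice_isSubLmodule of fixed_space by <:].

Lemma fixed_spaceP (v : fixed_space) : p (val v) = val v.
Proof. exact/eqP/(valP v). Qed.

Definition fixed_norm (v : fixed_space) : C := `|val v|.

Fact fixed_normD x y : fixed_norm (x + y) <= fixed_norm x + fixed_norm y.
Proof. by rewrite /fixed_norm raddfD ler_normD. Qed.

Fact fixed_normZ (a : C) x : fixed_norm (a *: x) = `|a| * fixed_norm x.
Proof. by rewrite /fixed_norm linearZ normrZ. Qed.

Fact fixed_norm_eq0 x : fixed_norm x = 0 -> x = 0.
Proof. by move/normr0_eq0=> x0; apply: val_inj; rewrite x0 raddf0. Qed.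

HB.instance Definition _ :=
  Lmodule_isNormed.Build C fixed_space fixed_normD fixed_normZ fixed_norm_eq0.

Fact fixed_space_complete (F : set_system fixed_space) :
  ProperFilter F -> cauchy F -> cvg F.
Proof.
move=> FF /cauchyP F_cauchy.
have G_cvg : cvg (val @ F).
  apply: cauchy_cvg; apply: cauchy_exP => e e0.
  have [x Fx] := F_cauchy e e0; exists (val x).
  rewrite -ball_normE; suff : F [set y | `|x - y| < e] by [].
  by apply: filterS Fx => y; rewrite -ball_normE.
set l := lim (val @ F) in G_cvg.
have G_near (e : C) : 0 < e -> F [set x | `|l - val x| < e].
  move=> e0; have : nbhs l (ball l e) by apply/nbhs_ballP; exists e.
  move/G_cvg; rewrite -ball_normE => Fl.
  by suff : F [set x | `|l - val x| < e] by [].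
have l_fixed : l \in fixed.
  apply/eqP; apply: (bounded_closed_eq p_bounded (@bounded_id _ K)).2 => e e0.
  have [x lx] := filter_ex (G_near e e0).
  by exists (val x) => //=; exact: fixed_spaceP.
apply/cvg_ex; exists (exist _ l l_fixed : fixed_space).
move=> A /nbhs_ballP[e /= e0 eA]; apply: filterS (G_near e e0) => x lx.
by apply: eA; rewrite -ball_normE /=.
Qed.

HB.instance Definition _ :=
  Uniform_isComplete.Build fixed_space fixed_space_complete.

Definition fixed_inner (v w : fixed_space) : C := inner (val v) (val w).

Fact fixed_inner_bilinear :
  bilinear_for ( *%R : C -> C -> C) (Num.conj \; *%R) fixed_inner.
Proof.
split=> z a x y.
  exact: (innerPl a (val x) (val y) (val z)).
exact: (innerPr a (val x) (val y) (val z)).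
Qed.

HB.instance Definition _ := bilinear_isBilinear.Build
  C fixed_space fixed_space C ( *%R) (Num.conj \; *%R) fixed_inner
  fixed_inner_bilinear.

Fact fixed_inner_hermitian v w :
  fixed_inner v w = (-1) ^+ false * Num.conj (fixed_inner w v).
Proof. by rewrite expr0 mul1r /fixed_inner -inner_conj. Qed.

HB.instance Definition _ := isHermitianSesquilinear.Build
  C fixed_space false Num.conj fixed_inner fixed_inner_hermitian.

Fact fixed_inner_gt0 v : v != 0 -> 0 < fixed_inner v v.
Proof.
move=> v0; rewrite /fixed_inner -inner_norm exprn_gt0// normr_gt0.
by apply: contra_neq v0 => v0; apply: val_inj; rewrite raddf0.
Qed.

HB.instance Definition _ := isDotProduct.Build
  C fixed_space fixed_inner fixed_inner_gt0.

Definition fixed_hilbert : hilbert R :=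
  @Hilbert R fixed_space fixed_inner (fun v => inner_norm (val v)).

End FixedSpace.

(** * Representations of star-algebras *)

Section StarRepresentations.
Variable R : realType.
Local Notation C := R[i].

(* [|r v - k|^2 >= 0], where [k] stands for the image of [v] under a
   self-adjoint [k] such that [r - k] is a square root of [r^2 - a^* a]. *)
Lemma norm_le_of_defect (K : hilbert R) (v a k : K) (r : C) : 0 <= r ->
  inner a a = r * inner k v + r * inner v k - inner k k -> `|a| <= r * `|v|.
Proof.
move=> r0 defect; rewrite -(@ler_pXn2r _ 2) ?nnegrE ?mulr_ge0// exprMn.
have : 0 <= inner (r *: v - k) (r *: v - k) by rewrite -inner_norm exprn_ge0.
rewrite !inner_norm defect !innerBl !innerBr !innerZl !innerZr.
rewrite (conj_Creal (ger0_real r0)) -subr_ge0; congr (0 <= _); ring.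
Qed.

Section StarRep.
Variables (A : star_algebra R) (K : hilbert R) (rho : A -> K -> K).
Hypothesis rho_rep : star_rep rho.

Lemma star_rep_linear a : carrier A a -> linear (rho a).
Proof. by case: rho_rep => + _ _ _ => /[apply] -[]. Qed.

Lemma star_rep0 v : carrier A 0 -> rho 0 v = 0.
Proof.
case: rho_rep => _ rhoZD _ _ A0; have := rhoZD (-1) 0 0 v A0 A0.
by rewrite scaler0 addr0 scaleN1r addNr.
Qed.

Lemma star_repZ (z : C) a v : carrier A 0 -> carrier A a ->
  rho (z *: a) v = z *: rho a v.
Proof.
case: rho_rep => _ rhoZD _ _ A0 Aa; have := rhoZD z a 0 v Aa A0.
by rewrite star_rep0// !addr0.
Qed.

Lemma star_repD a b v : carrier A a -> carrier A b ->
  rho (a + b) v = rho a v + rho b v.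
Proof.
case: rho_rep => _ rhoZD _ _ Aa Ab; have := rhoZD 1 a b v Aa Ab.
by rewrite !scale1r.
Qed.

Lemma star_rep_square a v : carrier A a -> carrier A (sstar a) ->
  inner (rho a v) (rho a v) = inner (rho (smul (sstar a) a) v) v.
Proof.
case: rho_rep => _ _ rhoM rhoV Aa Aa'.
by rewrite rhoM// rhoV.
Qed.

End StarRep.

(** A positive complex number is real, so the archimedean property of [R] applies. *)
Lemma exp_half_small (e : C) : 0 < e -> exists n, 2^-1 ^+ n < e.
Proof.
move=> e0; pose x := complex.Re e.
have xE : (x%:C)%C = e by apply/RRe_real/gtr0_real.
have x0 : 0 < x by rewrite -ltcR xE.
exists (Num.bound x^-1); rewrite -xE exprVn invf_plt ?posrE ?exprn_gt0 ?ltcR//.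
rewrite -[((x%:C)%C)^-1](fmorphV (real_complex R)) /=.
apply: (@lt_trans _ _ (((Num.bound x^-1)%:R : R)%:C)%C).
  by rewrite ltcR archi_boundP// invr_ge0 ltW.
by rewrite rmorph_nat -natrX ltr_nat ltn_expl.
Qed.

(** * Square roots and automatic continuity in C*-algebras *)

Section CStar.
Variable B : cstar_algebra R.
Implicit Types a b h k l : B.

Lemma cmulBr a b k : cmul a (b - k) = cmul a b - cmul a k.
Proof. exact: (linear_propB (cmul_linearr a)). Qed.

Lemma cmulBl a b k : cmul (b - k) a = cmul b a - cmul k a.
Proof. exact: (linear_propB (cmul_linearl a)). Qed.

Lemma cstar0 : cstar (0 : B) = 0.
Proof.
by have := cstar_conjlinear (-1) 0 (0 : B);
  rewrite scaler0 addr0 rmorphN1 scaleN1r addNr.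
Qed.

Lemma cstarD a b : cstar (a + b) = cstar a + cstar b.
Proof. by have := cstar_conjlinear 1 a b; rewrite rmorph1 !scale1r. Qed.

Lemma cstarZ (z : C) a : cstar (z *: a) = Num.conj z *: cstar a.
Proof. by have := cstar_conjlinear z a 0; rewrite cstar0 !addr0. Qed.

Lemma cstarB a b : cstar (a - b) = cstar a - cstar b.
Proof.
by rewrite cstarD -scaleN1r cstarZ rmorphN1 scaleN1r.
Qed.

Lemma cstar_norm a : `|cstar a| = `|a|.
Proof.
have le b : `|b| <= `|cstar b|.
  have [->|b0] := eqVneq b 0; first by rewrite normr0.
  have := cnormM (cstar b) b; rewrite cnorm_star expr2 ler_pM2r//.
  by rewrite normr_gt0.
by apply/le_anti; rewrite le andbT -[X in _ <= `|X|]cstarK le.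
Qed.

(* Fixed point of [k |-> (h + k^2) / 2], a contraction of the ball of radius
   1/2: then [1 - k] is a square root of [1 - h]. *)
Lemma cstar_square_root h : `|h| <= 4^-1 -> cstar h = h ->
  exists2 k, cstar k = k & k + k = h + cmul k k.
Proof.
move=> h_small h_sa; pose T k := 2^-1 *: (h + cmul k k).
have ge20 : 0 <= (2^-1 : C) by rewrite invr_ge0.
have T_lip k l : `|k| <= 2^-1 -> `|l| <= 2^-1 ->
  `|T k - T l| <= 2^-1 * `|k - l|.
  move=> k1 l1; rewrite /T -scalerBr normrZ ger0_norm// ler_wpM2l//.
  rewrite opprD addrACA subrr add0r.
  have -> : cmul k k - cmul l l = cmul k (k - l) + cmul (k - l) l.
    by rewrite cmulBr cmulBl addrA subrK.
  apply: le_trans (ler_normD _ _) _.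
  have -> : `|k - l| = 2^-1 * `|k - l| + `|k - l| * 2^-1 :> C by field.
  apply: lerD; apply: le_trans (cnormM _ _) _.
    by rewrite ler_wpM2r.
  by rewrite ler_wpM2l.
have T_ball k : `|k| <= 2^-1 -> `|T k| <= 2^-1.
  move=> k1; rewrite /T normrZ ger0_norm//.
  have half : 2^-1 * (2^-1 + 2^-1) = 2^-1 :> C by field.
  rewrite -[leRHS]half ler_wpM2l//; apply: le_trans (ler_normD _ _) _;
    apply: lerD.
    by apply: le_trans h_small _; rewrite lef_pV2 ?posrE// ler_nat.
  apply: le_trans (cnormM _ _) _; apply: le_trans (ler_pM _ _ k1 k1) _ => //.
  by rewrite ler_piMr// invf_le1// ler1n.
have T_sa k : cstar k = k -> cstar (T k) = T k.
  move=> k_sa; rewrite /T cstarZ cstarD cstarM k_sa h_sa.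
  by rewrite (conj_Creal (ger0_real ge20)).
(* Approximate fixed points: these sets are nonempty by iteration from 0 and have diameter at most
   [4 e], so they generate a Cauchy filter. *)
pose U (e : C) : set B :=
  [set k | [/\ cstar k = k, `|k| <= 2^-1 & `|k - T k| <= e]].
have U_ne e : 0 < e -> U e !=set0.
  move=> /exp_half_small[n ne]; exists (iter n T 0).
  have iter_ball m : `|iter m T 0| <= 2^-1.
    by elim: m => [|m IHm]; [rewrite normr0 | exact: T_ball].
  have iter_sa m : cstar (iter m T 0) = iter m T 0.
    by elim: m => [|m IHm]; [exact: cstar0 | exact: T_sa].
  split=> //; apply: le_trans (ltW ne).
  elim: n {ne} => [|n IHn].
    rewrite expr0 sub0r normrN; apply: le_trans (T_ball _ _) _;
      rewrite ?normr0//.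
    by rewrite invf_le1// ler1n.
  rewrite exprS iterS; apply: le_trans (T_lip _ _ _ _) _ => //.
    by apply: T_ball.
  by rewrite ler_wpM2l.
have U_diam e k l : U e k -> U e l -> `|k - l| <= e * 4.
  move=> [_ k1 ke] [_ l1 le].
  have : `|k - l| <= e + 2^-1 * `|k - l| + e.
    have kl : (k - T k) + (T k - T l) + (T l - l) = k - l by rewrite !subrKA.
    rewrite -[X in `|X| <= _]kl.
    apply: le_trans (ler_normD _ _) _; apply: lerD; last by rewrite distrC.
    by apply: le_trans (ler_normD _ _) _; apply: lerD => //; apply: T_lip.
  rewrite addrAC -lerBlDr.
  have -> : `|k - l| - 2^-1 * `|k - l| = `|k - l| / 2 :> C by field.
  rewrite ler_pdivrMr// => /le_trans; apply.
  by have -> : (e + e) * 2 = e * 4 by ring.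
pose FB := filter_from [set e : C | 0 < e] U.
have U_mono d e : d <= e -> U d `<=` U e.
  by move=> de k [k_sa k1 kd]; split=> //; apply: le_trans de.
have FB_filter : Filter FB.
  apply: filter_from_filter => [|d e /= d0 e0]; first by exists 1 => /=.
  have [c [c0 cd ce]] := common_lower_bound d0 e0.
  by exists c => // k Uk; split; apply: U_mono Uk.
have FB_proper : ProperFilter FB by apply: filter_from_proper => e; apply: U_ne.
have FB_cvg : cvg FB.
  apply: cauchy_cvg; apply: cauchy_exP => e e0.
  (* A fifth, so that the diameter [4 e / 5] is strictly less than [e]. *)
  have d0 : 0 < e / 5 by rewrite divr_gt0.
  have [k Uk] := U_ne _ d0; exists k, (e / 5) => // l Ul.
  rewrite -ball_normE /=; apply: le_lt_trans (U_diam _ _ _ Uk Ul) _.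
  by rewrite mulrAC ltr_pdivrMr// ltr_pM2l// ltr_nat.
set l := lim FB in FB_cvg.
have l_near e : 0 < e -> exists2 k, U e k & `|l - k| < e.
  move=> e0; have : nbhs l (ball l e) by apply/nbhs_ballP; exists e.
  move=> /FB_cvg[d /= d0 Ud]; have [c [c0 cd ce]] := common_lower_bound d0 e0.
  have [k Uk] := U_ne _ c0; exists k; first exact: U_mono Uk.
  by have := Ud _ (U_mono _ _ cd _ Uk); rewrite -ball_normE.
have l_sa : cstar l = l.
  apply/eqP; rewrite -subr_eq0; apply/eqP/norm_le_small => e e0.
  have [k [k_sa _ _] lk] := l_near (e / 2) (divr_gt0 e0 (ltr0Sn _ 1)).
  have -> : cstar l - l = cstar (l - k) - (l - k).
    by rewrite cstarB k_sa opprB addrA subrK.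
  apply: le_trans (ler_normB _ _) _; rewrite cstar_norm [e]splitr.
  by apply: lerD; apply: ltW.
have l1 : `|l| <= 2^-1.
  rewrite -subr_le0; apply/negPn/negP.
  rewrite -real_ltNge ?real0 ?rpredB ?normr_real ?ger0_real// => l_gt.
  have [k [_ k1 _] lk] := l_near _ l_gt.
  suff : `|l| < `|l| by rewrite ltxx.
  rewrite -{1}(subrK k l); apply: le_lt_trans (ler_normD _ _) _.
  by rewrite -ltrBrDr; apply: lt_le_trans lk _; rewrite lerD2l lerN2.
have l_fix : T l = l.
  apply/esym/eqP; rewrite -subr_eq0; apply/eqP/norm_le_small => e e0.
  have [k [_ k1 ke] lk] := l_near (e / 3) (divr_gt0 e0 (ltr0Sn _ 2)).
  have -> : l - T l = (l - k) + (k - T k) + (T k - T l).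
    by rewrite !subrKA.
  have -> : e = e / 3 + e / 3 + e / 3 by field.
  apply: le_trans (ler_normD _ _) _; apply: lerD.
    by apply: le_trans (ler_normD _ _) _; apply: lerD => //; apply: ltW.
  apply: le_trans (T_lip _ _ _ _) _ => //; rewrite distrC.
  apply: le_trans (ltW lk). by rewrite ler_piMl// invf_le1// ler1n.
have Tl : (2 : C) *: T l = h + cmul l l by rewrite /T scalerA divff// scale1r.
by exists l; rewrite // -Tl l_fix scaler_nat mulr2n.
Qed.

(** For a small multiple [a] of [b], [1 - a^* a] is formally the square of a self-adjoint [1 - k],
    and positivity of that square bounds [pi a]. The point is uniformity in [b], which [star_rep]
    does not contain. *)
Lemma cstar_rep_bounded (K : hilbert R) (pi : cstar_alg B -> K -> K) b v :
  star_rep pi -> `|pi b v| <= 2 * `|v| * `|b|.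
Proof.
move=> pi_rep; have [->|b0] := eqVneq b 0.
  by rewrite (star_rep0 pi_rep)// !normr0 mulr0.
have nb0 : 0 < `|b| by rewrite normr_gt0.
(* The factor 2 makes [|a^* a|] equal to the [4^-1] of [cstar_square_root]; it reappears in the
   final bound. *)
pose a : B := (2 * `|b|)^-1 *: b.
have a_norm : `|a| = 2^-1.
  rewrite normrZ gtr0_norm ?invr_gt0 ?mulr_gt0// invfM -mulrA.
  by rewrite mulVf ?mulr1// lt0r_neq0.
have [k k_sa kk] : exists2 k : B, cstar k = k & k + k = cmul (cstar a) a + cmul
  k k.
  apply: cstar_square_root; last by rewrite cstarM cstarK.
  by rewrite cnorm_star a_norm exprVn -natrX.
suff : `|pi a v| <= 1 * `|v|.
  rewrite (star_repZ pi_rep)// normrZ gtr0_norm ?invr_gt0 ?mulr_gt0//.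
  by rewrite mul1r ler_pdivrMl ?mulr_gt0// mulrAC.
apply: (@norm_le_of_defect _ _ _ (pi k v)) => //.
rewrite (star_rep_square pi_rep)//= !mul1r.
have [_ _ piM piV] := pi_rep.
have pikk : pi (cmul k k) v = pi k (pi k v) by exact: piM.
have -> : inner (pi k v) (pi k v) = inner (pi (cmul k k) v) v.
  by have /= := piV k (pi k v) v Logic.I; rewrite k_sa pikk => ->.
have -> : inner v (pi k v) = inner (pi k v) v.
  by have /= := piV k v v Logic.I; rewrite k_sa => ->.
rewrite -innerDl -innerBl -(star_repD pi_rep)//.
by rewrite kk (star_repD pi_rep)// addrK.
Qed.

Lemma cstar_rep_bounded_operator (K : hilbert R) (pi : cstar_alg B -> K ->
  K) v :
  star_rep pi -> bounded_operator (fun b : B => pi b v).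
Proof.
move=> pi_rep; split=> [a x y|]; first by case: pi_rep => _ ->.
by exists (2 * `|v|) => b; apply: cstar_rep_bounded.
Qed.

End CStar.
End StarRepresentations.

(** * Representations of c_0(I) and point masses *)

Section C0.
Variables (R : realType) (I : choiceType).
Local Notation C := R[i].
Local Notation c0 := (c0 R I).

Lemma c0_dominated (f g : I -> C) (M : C) : 0 < M -> carrier c0 f ->
  (forall i, `|g i| <= M * `|f i|) -> carrier c0 g.
Proof.
move=> M0 f0 gf e e0; apply: sub_finite_set (f0 _ (divr_gt0 e0 M0)) => i /= ei.
by rewrite ler_pdivrMr// mulrC; apply: le_trans (gf i).
Qed.

Lemma c0_finite (f : I -> C) : finite_set [set i | f i != 0] -> carrier c0 f.
Proof.
move=> finf e e0; apply: sub_finite_set finf => i /= ei.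
by rewrite -normr_gt0; apply: lt_le_trans ei.
Qed.

Lemma c0_0 : carrier c0 0.
Proof.
apply: c0_finite; rewrite (_ : [set _ | _] = set0)//.
by apply/seteqP; split=> // i /=; rewrite eqxx.
Qed.

Lemma c0_pointmass i : carrier c0 (pointmass R i).
Proof.
apply: c0_finite; apply: sub_finite_set (finite_set1 i) => j /=.
by rewrite /pointmass; case: (j =P i) => // _; rewrite eqxx.
Qed.

(** These projections form an approximate unit of [c0]. *)
Definition finite_indicator (r : seq I) : I -> C := fun i => (i \in r)%:R.

Lemma c0_finite_indicator r : carrier c0 (finite_indicator r).
Proof.
apply: c0_finite; apply: sub_finite_set (finite_seq r) => j /=.
by rewrite /finite_indicator; case: (j \in r) => //; rewrite eqxx.
Qed.

Lemma pointmass_eq0 (i j : I) : i != j -> smul (pointmass R i :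
  c0) (pointmass R j) = 0.
Proof.
move=> ij; apply/funext => k /=; rewrite /pointmass.
by case: eqVneq => [->|]; rewrite ?mul0r// (negPf ij) mulr0.
Qed.

Lemma pointmass_idem (i : I) : smul (pointmass R i :
  c0) (pointmass R i) = pointmass R i.
Proof.
by apply/funext => k /=; rewrite /pointmass; case: eqP; rewrite ?mulr1// mulr0.
Qed.

Section Representation.
Variables (K : hilbert R) (nu : c0 -> K -> K).
Hypothesis nu_rep : representation nu.

(** The defect argument with an explicit root: [k] solves [2 r k - k^2 = |f|^2] pointwise. It lies
    in [c0] because [0 <= k <= |f|], whereas [r - k] need not vanish at infinity. *)
Lemma c0_rep_contractive (f : I -> C) (r : C) v : carrier c0 f -> 0 < r ->
  (forall i, `|f i| <= r) -> `|nu f v| <= r * `|v|.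
Proof.
move=> f0 r0 fr; have nu_star := nu_rep.1.
pose k : c0 := fun i => r - sqrtC (r ^+ 2 - `|f i| ^+ 2).
have sq_ge0 i : 0 <= r ^+ 2 - `|f i| ^+ 2.
  by rewrite subr_ge0 ler_pXn2r ?nnegrE ?(ltW r0).
have s_ge0 i : 0 <= sqrtC (r ^+ 2 - `|f i| ^+ 2) by rewrite sqrtC_ge0.
have sqK i : sqrtC (r ^+ 2 - `|f i| ^+ 2) ^+ 2 = r ^+ 2 - `|f i| ^+ 2
  by rewrite sqrtCK.
have s_le i : sqrtC (r ^+ 2 - `|f i| ^+ 2) <= r.
  rewrite -(@ler_pXn2r _ 2) ?nnegrE ?(ltW r0)// sqK.
  by rewrite gerBl exprn_ge0.
have k_ge0 i : 0 <= k i by rewrite subr_ge0.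
have kk_ge0 i : 0 <= k i + k i by apply: addr_ge0; apply: k_ge0.
have k_le i : k i <= `|f i|.
  rewrite lerBlDl -lerBlDr -(@ler_pXn2r _ 2) ?nnegrE ?subr_ge0// sqK -subr_ge0.
  have -> : r ^+ 2 - `|f i| ^+ 2 - (r - `|f i|) ^+ 2 = 2 *
    (`|f i| * (r - `|f i|)).
    by ring.
  by rewrite !mulr_ge0// subr_ge0.
have c0k : carrier c0 k.
  by apply: (c0_dominated ltr01 f0) => i; rewrite mul1r ger0_norm.
have c0f' : carrier c0 (sstar (f : c0)).
  by apply: (c0_dominated ltr01 f0) => i; rewrite mul1r norm_conjC.
have k_sa : sstar k = k.
  by apply/funext => i /=; rewrite conj_Creal// ger0_real.
have c0ff : carrier c0 (smul (sstar (f : c0)) (f : c0)).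
  by apply: (c0_dominated r0 f0) => i; rewrite normrM norm_conjC ler_wpM2r.
have c0kk : carrier c0 (smul k k).
  apply: (c0_dominated r0 f0) => i; rewrite normrM ger0_norm// mulrC.
  apply: le_trans (ler_wpM2l (k_ge0 i) (k_le i)) _; rewrite ler_wpM2r//.
  by apply: le_trans (k_le i) _.
have c0rk : carrier c0 (r *: (k + k)).
  apply: (@c0_dominated f _ (r * 2)) => [||i]; rewrite ?mulr_gt0//.
  rewrite -[X in `|X|]/(r * (k i + k i)) normrM gtr0_norm// -mulrA.
  rewrite ler_wpM2l ?(ltW r0)// mulrDl mul1r.
  by rewrite (ger0_norm (kk_ge0 i)) lerD.
have c0k2 : carrier c0 (k + k).
  apply: (@c0_dominated f _ 2) => // i.
  rewrite -[X in `|X|]/(k i + k i) mulrDl mul1r.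
  by rewrite (ger0_norm (kk_ge0 i)) lerD.
have [_ _ nuM nuV] := nu_star.
apply: (@norm_le_of_defect _ _ _ _ (nu k v)) => //; first exact: ltW.
rewrite (star_rep_square nu_star)//.
have -> : inner (nu k v) (nu k v) = inner (nu (smul k k) v) v.
  by have := nuV k (nu k v) v c0k; rewrite k_sa nuM// => ->.
have -> : inner v (nu k v) = inner (nu k v) v.
  by have := nuV k v v c0k; rewrite k_sa => ->.
rewrite -mulrDr -innerDl -(star_repD nu_star)// -innerZl.
rewrite -(star_repZ nu_star) //; last exact: c0_0.
apply/esym/eqP; rewrite subr_eq eq_sym -innerDl -(star_repD nu_star)//.
apply/eqP; congr (inner (nu _ v) v); apply/funext => i /=.
rewrite -[LHS]/(Num.conj (f i) * f i + k i * k i) -[RHS]/(r * (k i + k i)).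
rewrite mulrC -normCK -[`|f i| ^+ 2](subKr (r ^+ 2)) /k.
by move: (sqrtC _) (sqK i) => s <-; ring.
Qed.

(** Decay of [f] gives the convergence on vectors [nu f w]; these are total by nondegeneracy, and
    contractivity of the indicators carries the convergence to limits. All larger [r'] are allowed
    so that several approximations can share one finite set. *)
Lemma c0_rep_approx v (e : C) : 0 < e ->
  exists r : seq I, forall r' : seq I, {subset r <= r'} ->
    `|v - nu (finite_indicator r') v| < e.
Proof.
move: v e; apply: (dense_lspan_min nu_rep.2).
- have nu_star := nu_rep.1; split=> [e e0|a x y Px Py e e0].
    exists [::] => r' _.
    rewrite (linear_prop0 (star_rep_linear nu_star (c0_finite_indicator _))).
    by rewrite subrr normr0.
  have a10 : 0 < `|a| + 1 by rewrite ltr_wpDl.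
  have [r Pr] := Px _ (divr_gt0 (divr_gt0 e0 (ltr0Sn _ 1)) a10).
  have [s Ps] := Py _ (divr_gt0 e0 (ltr0Sn _ 1)).
  exists (r ++ s) => r' rs.
  have {}Pr : `|x - nu (finite_indicator r') x| < e / 2 / (`|a| + 1).
    by apply: Pr => i ir; apply: rs; rewrite mem_cat ir.
  have {}Ps : `|y - nu (finite_indicator r') y| < e / 2.
    by apply: Ps => i ir; apply: rs; rewrite mem_cat ir orbT.
  rewrite (star_rep_linear nu_star (c0_finite_indicator _)).
  by rewrite opprD addrACA -scalerBr; apply: norm_axpy_lt.
- move=> v Pv e e0; have nu_star := nu_rep.1.
  have e30 : 0 < e / 3 by rewrite divr_gt0.
  have [w Pw vw] := Pv _ e30; have [r Pr] := Pw _ e30; exists r => r' rr'.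
  have {}Pr := Pr r' rr'.
  have nu_lin := star_rep_linear nu_star (c0_finite_indicator r').
  have E : (v - w) + (w - nu (finite_indicator r') w) +
      nu (finite_indicator r') (w - v) = v - nu (finite_indicator r') v.
    by rewrite (linear_propB nu_lin) !subrKA.
  rewrite -E; have -> : e = e / 3 + e / 3 + e / 3 by field.
  apply: le_lt_trans (ler_normD _ _) _; apply: ltr_leD.
    by apply: le_lt_trans (ler_normD _ _) _; apply: ltrD.
  apply: le_trans (ltW vw).
  rewrite distrC -[leRHS]mul1r; apply: c0_rep_contractive => //.
    exact: c0_finite_indicator.
  by move=> i; rewrite /finite_indicator; case: (i \in r');
    rewrite ?normr1 ?normr0.
- move=> _ [f [w [f0 ->]]] e e0.
  have [nu_star _] := nu_rep; have [_ _ nuM _] := nu_star.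
  have w10 : 0 < `|w| + 1 by rewrite ltr_wpDl.
  pose d := e / (`|w| + 1); have d0 : 0 < d by rewrite divr_gt0.
  (* Off this finite set [|f|] is below [d], and [d |w| < e]. *)
  have /finite_seqP[r rE] := f0 _ d0; exists r => r' rr'.
  have f'0 : carrier c0 (smul (finite_indicator r' : c0) f).
    apply: (c0_dominated ltr01 f0) => i; rewrite /finite_indicator mul1r /=.
    by case: (i \in r'); rewrite ?mul1r// mul0r normr0.
  rewrite -nuM//; last exact: c0_finite_indicator.
  rewrite -scaleN1r -[nu f w]scale1r addrC scale1r.
  have [_ nuZD _ _] := nu_star; rewrite -nuZD//.
  apply: le_lt_trans (c0_rep_contractive (r := d) _ _ d0 _) _.
  + apply: (c0_dominated ltr01 f0) => i.
    rewrite -[X in `|X|]/(-1 * (finite_indicator r' i * f i) + f i) mul1r.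
    rewrite /finite_indicator; case: (i \in r').
      by rewrite mul1r mulN1r addNr normr0.
    by rewrite mul0r mulr0 add0r.
  + move=> i.
    rewrite -[X in `|X|]/(-1 * (finite_indicator r' i * f i) + f i).
    rewrite /finite_indicator; case: (boolP (i \in r')) => ir'.
      by rewrite mul1r mulN1r addNr normr0 ltW.
    rewrite mul0r mulr0 add0r.
    have fi_real : `|f i| \is Num.real by rewrite normr_real.
    rewrite real_leNgt ?(gtr0_real d0)//; move: ir'; apply: contra => fi;
      apply: rr'.
    suff : [set` r] i by [].
    by rewrite -rE /=; apply: ltW.
  + rewrite /d mulrAC ltr_pdivrMr// ltr_pM2l//.
    by rewrite ltrDl.
Qed.

Lemma c0_rep_finite_indicator r v : uniq r ->
  nu (finite_indicator r) v = \sum_(i <- r) nu (pointmass R i) v.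
Proof.
have nu_star := nu_rep.1; elim: r => [_|i r IHr /= /andP[ir r_uniq]].
  by rewrite big_nil -(star_rep0 nu_star v c0_0); congr (nu _ v).
rewrite big_cons -IHr// -(star_repD nu_star); last 2 first.
- exact: c0_pointmass.
- exact: c0_finite_indicator.
congr (nu _ v); apply/funext => j.
rewrite -[RHS]/(pointmass R i j + finite_indicator r j).
rewrite /finite_indicator /pointmass inE; case: eqVneq => [->|] /=.
  by rewrite (negPf ir) addr0.
by rewrite add0r.
Qed.

Lemma c0_rep_total :
  dense (lspan [set w | exists i v, w = nu (pointmass R i) v]).
Proof.
apply/denseP => v e e0; have [r rP] := c0_rep_approx v e0.
exists (nu (finite_indicator (undup r)) v).
  rewrite c0_rep_finite_indicator ?undup_uniq//.
  apply: linear_set_sum => [|i]; first exact: lspan_linear.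
  by apply: sub_lspan; exists i, v.
by apply: rP => i; rewrite mem_undup.
Qed.

Lemma pointmass_proj i v :
  nu (pointmass R i) (nu (pointmass R i) v) = nu (pointmass R i) v.
Proof.
have [_ _ nuM _] := nu_rep.1.
by rewrite -nuM ?pointmass_idem//; apply: c0_pointmass.
Qed.

Lemma pointmass_orth i j v : i != j ->
  nu (pointmass R i) (nu (pointmass R j) v) = 0.
Proof.
move=> ij; have [_ _ nuM _] := nu_rep.1.
rewrite -nuM ?pointmass_eq0//; try exact: c0_pointmass.
exact: (star_rep0 nu_rep.1 _ c0_0).
Qed.

Lemma pointmass_adj i v w :
  inner (nu (pointmass R i) v) w = inner v (nu (pointmass R i) w).
Proof.
have [_ _ _ nuV] := nu_rep.1; rewrite -nuV; last exact: c0_pointmass.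
congr (inner (nu _ v) w); apply/funext => j /=.
by rewrite /pointmass conjC_nat.
Qed.

Lemma c0_rep_eval f i v : carrier c0 f ->
  nu f (nu (pointmass R i) v) = f i *: nu (pointmass R i) v.
Proof.
move=> f0; have [nu_star _] := nu_rep; have [_ _ nuM _] := nu_star.
rewrite -nuM//; last exact: c0_pointmass.
rewrite -(star_repZ nu_star); [|exact: c0_0|exact: c0_pointmass].
congr (nu _ v); apply/funext => j /=.
rewrite -[RHS]/(f i * pointmass R i j) /pointmass.
by case: eqP => [->|]; rewrite ?mulr0.
Qed.

End Representation.
End C0.

(** * Cosets and double cosets *)

Section Cosets.
Variables (G : groupType) (H : groupClosed G).
Implicit Types (g a b : G) (x y z : lcosets H).

Lemma lcoset_eqP a b : lcoset H a = lcoset H b <-> (a^-1 * b)%g \in H.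
Proof. by split=> [/eqmodP|ab]; last by apply/eqmodP. Qed.

Lemma lcoset_reprK y : lcoset H (repr y) = y.
Proof. exact: reprK. Qed.

Lemma lcoset_repr_rel a : (a^-1 * repr (lcoset H a))%g \in H.
Proof. by apply/lcoset_eqP; rewrite lcoset_reprK. Qed.

Lemma lcoset_actE g a : lcoset_act g (lcoset H a) = lcoset H (g * a)%g.
Proof.
apply/lcoset_eqP; rewrite invgM mulgA mulgVK -gpredV invgM invgK.
exact: lcoset_repr_rel.
Qed.

Lemma lcoset_act1 y : lcoset_act 1%g y = y.
Proof. by rewrite -[y]lcoset_reprK lcoset_actE mul1g. Qed.

Lemma lcoset_actM g a y : lcoset_act (g * a)%g y = lcoset_act g (lcoset_act a
  y).
Proof. by rewrite -[y]lcoset_reprK !lcoset_actE mulgA. Qed.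

Lemma lcoset_actK g : cancel (@lcoset_act _ H g) (lcoset_act g^-1%g).
Proof. by move=> y; rewrite -lcoset_actM mulVg lcoset_act1. Qed.

Lemma lcoset_actKV g : cancel (@lcoset_act _ H g^-1%g) (lcoset_act g).
Proof. by move=> y; rewrite -lcoset_actM mulgV lcoset_act1. Qed.

Lemma lcoset_act_repr y : lcoset_act (repr y) (lcoset H 1%g) = y.
Proof. by rewrite lcoset_actE mulg1 lcoset_reprK. Qed.

Lemma dcoset_eqP a b :
  dcoset H a = dcoset H b <->
    exists h k, [/\ h \in H, k \in H & b = (h * a * k)%g].
Proof.
by split=> [/eqmodP/asboolP|ab]; last by apply/eqmodP/asboolP.
Qed.

Lemma dcoset_mul h a k : h \in H -> k \in H ->
  dcoset H (h * a * k)%g = dcoset H a.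
Proof. by move=> hH kH; apply/esym/dcoset_eqP; exists h, k. Qed.

Lemma dcoset_reprK (D : dcosets H) : dcoset H (repr D) = D.
Proof. exact: reprK. Qed.

Definition dcoset_inv (D : dcosets H) : dcosets H := dcoset H (repr D)^-1%g.

Lemma dcoset_invE a : dcoset_inv (dcoset H a) = dcoset H a^-1%g.
Proof.
have /dcoset_eqP[h [k [hH kH E]]] := dcoset_reprK (dcoset H a).
apply/dcoset_eqP; exists k^-1%g, h^-1%g; rewrite !gpredV; split=> //.
by rewrite [in LHS]E !invgM !mulgA.
Qed.

Lemma dcoset_invK : involutive dcoset_inv.
Proof.
by move=> D; rewrite -[D]dcoset_reprK !dcoset_invE invgK.
Qed.

(** The relative position of two cosets: a complete invariant of pairs under the diagonal action of
    [G]. By [dcoset_betweenE] it does not depend on the representatives. *)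
Definition dcoset_between x y : dcosets H := dcoset H ((repr x)^-1 * repr y)%g.

Lemma dcoset_betweenE a b :
  dcoset_between (lcoset H a) (lcoset H b) = dcoset H (a^-1 * b)%g.
Proof.
have aH := lcoset_repr_rel a; have bH := lcoset_repr_rel b.
rewrite -(@dcoset_mul (a^-1 * repr (lcoset H a))^-1%g _ (b^-1 * repr
  (lcoset H b))%g) ?gpredV//.
congr (dcoset H _); rewrite invgM invgK !mulgA mulgK.
by rewrite -!mulgA mulVKg.
Qed.

Lemma dcoset_between_act g x y :
  dcoset_between (lcoset_act g x) (lcoset_act g y) = dcoset_between x y.
Proof.
rewrite -[x]lcoset_reprK -[y]lcoset_reprK !lcoset_actE !dcoset_betweenE.
by rewrite invgM mulgA mulgVK.
Qed.

Lemma dcoset_between_sym x y : dcoset_between y x = dcoset_inv (dcoset_between x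
  y).
Proof. by rewrite dcoset_invE invgM invgK. Qed.

Lemma dcoset_between_id x : dcoset_between x x = dcoset H 1%g.
Proof. by rewrite /dcoset_between mulVg. Qed.

Lemma dcoset_between_eq1 x y : dcoset_between x y = dcoset H 1%g -> x = y.
Proof.
move=> /esym/dcoset_eqP[h [k [hH kH]]]; rewrite mulg1 => xy.
rewrite -[x]lcoset_reprK -[y]lcoset_reprK; apply/lcoset_eqP.
by rewrite xy gpredM.
Qed.

Lemma dcoset_between1 y : dcoset_between (lcoset H 1%g) y = dcoset H (repr y).
Proof. by rewrite -{1}[y]lcoset_reprK dcoset_betweenE invg1 mul1g. Qed.

Lemma lcosets_inP (D : dcosets H) y : lcosets_in D y <-> dcoset H (repr y) = D.
Proof.
split=> [yD|yD z /= zy]; first exact: (yD (repr y) (lcoset_reprK y)).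
rewrite -yD; apply/dcoset_eqP; exists 1%g, (z^-1 * repr y)%g.
by rewrite gpred1 mul1g mulVKg; split=> //; apply/lcoset_eqP;
  rewrite lcoset_reprK.
Qed.

End Cosets.

(** * The Schur test *)

(** Any list containing the support will do, so that sums with different supports can be brought to
    one common list. *)
Lemma fsumT_seq (I : choiceType) (V : nmodType) (r : seq I) (f : I -> V) :
  uniq r -> (forall x, x \notin r -> f x = 0) ->
  \sum_(x \in [set: I]) f x = \sum_(x <- r) f x.
Proof.
move=> r_uniq f0; rewrite (fsbigE r)// => [|x _]; last exact: f0.
by apply: eq_bigl => x; rewrite in_setT.
Qed.

Lemma fsum_seq (I : choiceType) (V : nmodType) (A : set I) : finite_set A ->
  exists r : seq I, [/\ uniq r, forall x, x \in r <-> A x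
    & forall f : I -> V, \sum_(x \in A) f x = \sum_(x <- r) f x].
Proof.
move=> /finite_seqP[r rE]; exists (undup r).
have AE : A = [set` undup r].
  by rewrite rE; apply/seteqP; split=> x /=; rewrite mem_undup.
split=> [|x|f]; first exact: undup_uniq.
  by rewrite AE.
by rewrite AE -fsbig_seq// undup_uniq.
Qed.

Section Schur.
Variables (R : realType) (I : choiceType).
Local Notation C := R[i].
Variables (W : lmodType C) (S : hilbert R) (j : I -> W -> S) (q : W -> W -> C).
Hypothesis j_lin : forall x, linear (j x).
Hypothesis j_orth : forall x y v w,
  inner (j x v) (j y w) = (x == y)%:R * q v w.

(** All slots carry the norm of the same form [q], so the estimates may move a vector from one slot
    to another. *)
Lemma orth_norm x y v : `|j x v| = `|j y v|.
Proof.
apply/eqP; rewrite -(@eqrXn2 _ 2)// !inner_norm !j_orth.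
by rewrite !eqxx.
Qed.

Lemma orth_pythagoras (r : seq I) (V : I -> W) : uniq r ->
  `|\sum_(x <- r) j x (V x)| ^+ 2 = \sum_(x <- r) `|j x (V x)| ^+ 2.
Proof.
move=> r_uniq; rewrite inner_norm inner_suml; apply: eq_big_seq => x xr.
rewrite inner_sumr (bigD1_seq x)//= big1 ?addr0 ?inner_norm// => y yx.
by rewrite j_orth eq_sym (negPf yx) mul0r.
Qed.

Variables (m : I -> I -> C) (c : C).
Hypothesis c_gt0 : 0 < c.
Hypothesis m_row : forall x r, uniq r -> \sum_(y <- r) `|m x y| <= c.
Hypothesis m_col : forall y r, uniq r -> \sum_(x <- r) `|m x y| <= c.

(** Row sums control each output slot; column sums control the total once the summations are
    exchanged. Each contributes one factor [c] to the squared norm. *)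
Lemma schur_bound (r s : seq I) (V : I -> W) : uniq r -> uniq s ->
  `|\sum_(y <- s) \sum_(x <- r) m x y *: j x (V y)|
    <= c * `|\sum_(y <- s) j y (V y)|.
Proof.
move=> r_uniq s_uniq; rewrite exchange_big /=.
under eq_bigr => x _.
  under eq_bigr do rewrite -(linear_propZ (j_lin x)).
  rewrite -(linear_prop_sum (j_lin x)); over.
rewrite -(@ler_pXn2r _ 2) ?nnegrE ?mulr_ge0 ?(ltW c_gt0)// exprMn.
rewrite !orth_pythagoras//.
have row_le x : `|j x (\sum_(y <- s) m x y *: V y)| ^+ 2
    <= c * \sum_(y <- s) `|m x y| * `|j y (V y)| ^+ 2.
  (* AM-GM: [2 c a_y b <= (c a_y)^2 + b^2] with [a_y = |j y (V y)|]. *)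
  set b := `|j x _|.
  have b_le : b <= \sum_(y <- s) `|m x y| * `|j y (V y)|.
    rewrite /b (linear_prop_sum (j_lin x));
      apply: le_trans (ler_norm_sum _ _ _) _.
    apply: ler_sum => y _; rewrite (linear_propZ (j_lin x)) normrZ.
    by rewrite (orth_norm x y).
  have b0 : 0 <= b by exact: normr_ge0.
  (* The added [c b^2] absorbs [b^2] times the row sum, which appears on the left after AM-GM. *)
  rewrite -(ler_pM2l c_gt0) -(lerD2r (c * b ^+ 2)).
  apply: (@le_trans _ _ (2 * c * b * \sum_(y <- s) `|m x y| * `|j y (V y)|)).
    have -> : c * b ^+ 2 + c * b ^+ 2 = 2 * c * b * b by ring.
    by rewrite ler_wpM2l// !mulr_ge0// ltW.
  apply: (@le_trans _ _ (\sum_(y <- s) `|m x y| * (c ^+ 2 * `|j y (V y)| ^+ 2 +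
    b ^+ 2))).
    rewrite mulr_sumr; apply: ler_sum => y _.
    rewrite mulrCA ler_wpM2l// -subr_ge0.
    have -> : c ^+ 2 * `|j y (V y)| ^+ 2 + b ^+ 2 - 2 * c * b * `|j y (V y)|
      = (c * `|j y (V y)| - b) ^+ 2 by ring.
    rewrite -realEsqr; apply: rpredB; last exact: normr_real.
    by apply: rpredM; [exact: gtr0_real | exact: normr_real].
  under eq_bigr do rewrite mulrDr mulrCA.
  rewrite big_split /= -mulr_sumr -mulr_suml [c ^+ 2]expr2 -mulrA lerD2l.
  by rewrite ler_wpM2r ?exprn_ge0// m_row.
apply: le_trans (ler_sum _ (fun x _ => row_le x)) _.
rewrite -mulr_sumr exchange_big /= expr2 -mulrA ler_wpM2l ?(ltW c_gt0)//.
rewrite mulr_sumr; apply: ler_sum => y _.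
by rewrite -mulr_suml ler_wpM2r ?exprn_ge0// m_col.
Qed.

Hypothesis j_total : dense (lspan [set z | exists x v, z = j x v]).
Hypothesis m_fin : forall y, finite_set [set x | m x y != 0].

Lemma schur_operator : exists T : S -> S, bounded_operator T /\
  forall y v, T (j y v) = \sum_(x \in [set: I]) m x y *: j x v.
Proof.
pose g (p : I * W) := j p.1 p.2.
pose g' (p : I * W) := \sum_(x \in [set: I]) m x p.1 *: j x p.2.
have g_total : dense (lspan (range g)).
  apply: dense_lspan_trans j_total _ => _ [x [v ->]].
  by apply: sub_closure_span; exists (x, v).
have [n d k|T [Tlin TM Tg]] := bounded_extension_family c_gt0 _ g_total (g' :=
  g').
  have /choice[supp suppP] : forall y, exists r : seq I,
      forall x, m x y != 0 -> x \in r.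
    move=> y; have /finite_seqP[r rE] := m_fin y.
    by exists r => x mxy; have : [set` r] x by rewrite -rE.
  pose s := undup [seq (k i).1 | i <- index_enum 'I_n].
  pose r := undup (flatten [seq supp y | y <- s]).
  have s_uniq : uniq s by exact: undup_uniq.
  have r_uniq : uniq r by exact: undup_uniq.
  have k_s i : (k i).1 \in s.
    by rewrite mem_undup; apply: map_f; rewrite mem_index_enum.
  (* Vectors placed in the same slot are merged, so that only distinct, hence orthogonal, slots
     remain. *)
  pose V y := \sum_(i | (k i).1 == y) d i *: (k i).2.
  have group (f : I -> W -> S) : (forall y, linear (f y)) ->
      \sum_i d i *: f (k i).1 (k i).2 = \sum_(y <- s) f y (V y).
    move=> f_lin; under [RHS]eq_bigr => y _.
      by rewrite (linear_prop_sum (f_lin y)); over.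
    rewrite (exchange_big_dep xpredT)//=; apply: eq_bigr => i _.
    rewrite -big_filter; have -> : [seq y <- s | (k i).1 == y] = [:: (k i).1].
      under eq_filter do rewrite eq_sym.
      by rewrite filter_pred1_uniq.
    by rewrite big_seq1 (linear_propZ (f_lin _)).
  have g'E i : g' (k i) = \sum_(x <- r) m x (k i).1 *: j x (k i).2.
    apply: fsumT_seq => // x xr.
    have [->|mx0] := eqVneq (m x (k i).1) 0; first by rewrite scale0r.
    case/negP: xr; rewrite mem_undup; apply/flattenP.
    by exists (supp (k i).1); [exact: map_f | exact: suppP].
  rewrite (eq_bigr _ (fun i _ => congr1 (fun v => d i *: v) (g'E i))).
  rewrite (group (fun y v => \sum_(x <- r) m x y *: j x v)); last first.
    move=> y a v w; rewrite scaler_sumr -big_split /=; apply: eq_bigr => x _.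
    by rewrite j_lin scalerDr !scalerA mulrC.
  by rewrite [X in _ <= c * `|X|](group j)//; apply: schur_bound.
exists T; split; first by split=> //; exists c.
by move=> y v; rewrite -[j y v]/(g (y, v)) Tg.
Qed.

End Schur.

(** * The Hecke algebra *)

Section HeckeAlgebra.
Variables (R : realType) (G : groupType) (H : groupClosed G).
Hypothesis hH : hecke_pair H.
Local Notation C := R[i].
Local Notation HA := (hecke_algebra H R).
Local Notation dcb := (@dcoset_between G H).
Implicit Types (x y z : lcosets H) (f g : HA).

Lemma hecke_char_carrier a : carrier HA (hecke_char H R a).
Proof.
apply: sub_finite_set (finite_set1 (dcoset H a)) => D /=.
by rewrite /hecke_char /pointmass; case: eqP => // _.
Qed.

Lemma hecke_char_star a : sstar (hecke_char H R a) = hecke_char H R a^-1%g.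
Proof.
apply/funext => D; rewrite /= /hecke_char /pointmass conjC_nat; congr (_%:R).
congr (nat_of_bool _); apply/eqP/eqP => [E|->].
  have {}E : dcoset_inv D = dcoset H a := E.
  by rewrite -[D]dcoset_invK E dcoset_invE.
by rewrite -/(dcoset_inv _) dcoset_invE invgK.
Qed.

Lemma hecke_carrier_axpy (c : C) f g : carrier HA f -> carrier HA g ->
  carrier HA (c *: f + g).
Proof.
move=> ff fg; apply: sub_finite_set (_ :
  finite_set ([set D | f D <> 0] `|` [set D | g D <> 0])).
  move=> D /= cfg0; apply: contrapT => /not_orP[/contrapT f0 /contrapT g0].
  apply: cfg0; rewrite -[LHS]/(c * f D + g D) f0 g0.
  by rewrite mulr0 addr0.
by rewrite finite_setU.
Qed.

Lemma hecke_carrier_star f : carrier HA f -> carrier HA (sstar f).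
Proof.
move=> ff; apply: sub_finite_set (finite_image (@dcoset_inv G H) ff) => D /= fD.
exists (dcoset_inv D); last exact: dcoset_invK.
by move=> f0; apply: fD; rewrite -/(dcoset_inv D) f0 conjC0.
Qed.

(** Translation by [x^-1] leads to the row of the base coset, whose support lies in finitely many
    double cosets, each containing finitely many left cosets by [hecke_pair]. *)
Lemma hecke_row_finite f x : carrier HA f ->
  finite_set [set y | f (dcb x y) != 0].
Proof.
move=> ff.
apply: (@sub_finite_set _ _ (lcoset_act (repr x) @`
  \bigcup_(D in [set D | f D <> 0]) lcosets_in D)).
  move=> y /= /eqP fxy; exists (lcoset_act (repr x)^-1%g y);
    last exact: lcoset_actKV.
  exists (dcb x y) => //; apply/lcosets_inP; rewrite -dcoset_between1.
  by rewrite -{2}(lcoset_act_repr x) -{2}[y](lcoset_actKV (repr x))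
    dcoset_between_act.
by apply: finite_image; apply: bigcup_finite => // D _; apply: hH.
Qed.

Lemma hecke_sstarE f x y : sstar f (dcb x y) = Num.conj (f (dcb y x)).
Proof. by rewrite (dcoset_between_sym x y). Qed.

(** Columns of [f] are the conjugated rows of [f^*]. *)
Lemma hecke_col_finite f y : carrier HA f ->
  finite_set [set x | f (dcb x y) != 0].
Proof.
move=> /hecke_carrier_star/(@hecke_row_finite _ y); apply: sub_finite_set => x.
by rewrite /mkset hecke_sstarE conjC_eq0.
Qed.

Lemma hecke_col_seq f (s : seq (lcosets H)) : carrier HA f ->
  exists2 r : seq (lcosets H), uniq r &
    forall x y, y \in s -> x \notin r -> f (dcb x y) = 0.
Proof.
move=> ff; elim: s => [|y s [r r_uniq rP]]; first by exists [::].
have /finite_seqP[t tE] := hecke_col_finite y ff.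
exists (undup (t ++ r)); first exact: undup_uniq.
move=> x z; rewrite inE mem_undup mem_cat negb_or =>
  /orP[/eqP->|zs] /andP[xt xr].
  apply/eqP/negPn/negP => fxy; case/negP: xt.
  by have : [set` t] x by rewrite -tE.
exact: rP xr.
Qed.

(** By invariance every row is a rearrangement of the row of the base coset, so one finite sum
    bounds them all; the added 1 makes it positive. *)
Lemma hecke_row_bound f : carrier HA f -> exists2 c : C, 0 < c &
  forall x r, uniq r -> \sum_(y <- r) `|f (dcb x y)| <= c.
Proof.
move=> ff; have /finite_seqP[t tE] := hecke_row_finite (lcoset H 1%g) ff.
pose F y : C := `|f (dcb (lcoset H 1%g) y)|.
have sum_ge0 s : 0 <= \sum_(y <- s) F y.
  by apply: sumr_ge0 => y _; apply: normr_ge0.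
exists (1 + \sum_(y <- undup t) F y) => [|x r r_uniq].
  by rewrite ltr_pwDl.
apply: (@le_trans _ _ (\sum_(y <- undup t) F y)); last by rewrite lerDr.
have -> : \sum_(y <- r) `|f (dcb x y)|
    = \sum_(y <- [seq lcoset_act (repr x)^-1%g y | y <- r]) F y.
  rewrite big_map; apply: eq_bigr => y _; rewrite /F.
  by rewrite -{1}(lcoset_act_repr x) -{1}[y](lcoset_actKV (repr x))
    dcoset_between_act.
set r' := map _ r.
have r'_uniq : uniq r' by rewrite map_inj_uniq//;
  apply: can_inj (lcoset_actKV _).
rewrite (bigID (mem t)) /= [X in _ + X]big1 => [|y yt]; last first.
  apply/eqP; rewrite normr_eq0; apply/negPn/negP => fy; case/negP: yt.
  by have : [set` t] y by rewrite -tE.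
rewrite addr0 -big_filter.
have tr' : perm_eq (seq.filter (mem t) r') (seq.filter (mem r') (undup t)).
  apply: uniq_perm; rewrite ?filter_uniq ?undup_uniq// => y.
  by rewrite !mem_filter mem_undup /= andbC.
rewrite (perm_big _ tr') big_filter big_mkcond; apply: ler_sum => y _.
by case: ifP => // _; apply: normr_ge0.
Qed.

Lemma hecke_col_bound f : carrier HA f -> exists2 c : C, 0 < c &
  forall y r, uniq r -> \sum_(x <- r) `|f (dcb x y)| <= c.
Proof.
move=> /hecke_carrier_star/hecke_row_bound[c c0 cP]; exists c => // y r r_uniq.
apply: le_trans (cP y r r_uniq); apply: ler_sum => x _.
by rewrite hecke_sstarE norm_conjC.
Qed.

(** The product of the Hecke algebra is defined at [repr D] by a sum based at [H]; such a [g] moves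
    that base pair to any pair in the same relative position. *)
Lemma dcoset_between_repr x z : exists2 g,
  lcoset_act g (lcoset H 1%g) = x & lcoset_act g (lcoset H (repr (dcb x z))) =
    z.
Proof.
have /dcoset_eqP[h [k [hH' kH E]]] := esym (dcoset_reprK (dcb x z)).
exists (repr x * h^-1)%g.
  rewrite lcoset_actE mulg1 -[RHS]lcoset_reprK; apply/lcoset_eqP.
  by rewrite invgM invgK mulgVK.
rewrite E lcoset_actE -[RHS]lcoset_reprK; apply/lcoset_eqP.
rewrite !mulgA mulgVK mulgV mul1g invgM mulgVK.
by rewrite gpredV.
Qed.

(** Reindexing the convolution by the translation [k] turns it into matrix multiplication. *)
Lemma hecke_smulE f g x z :
  smul f g (dcb x z) = \sum_(y \in [set: lcosets H]) f (dcb x y) * g (dcb y z).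
Proof.
have [k kx kz] := dcoset_between_repr x z.
have k_bij : bijective (@lcoset_act _ H k).
  by exists (lcoset_act k^-1%g); [exact: lcoset_actK | exact: lcoset_actKV].
rewrite [RHS](reindex_fsbigT (lcoset_act k) _ k_bij); apply: eq_fsbigr => y _.
congr (f _ * g _).
  by rewrite -[in RHS]kx dcoset_between_act dcoset_between1.
rewrite -[in RHS]kz dcoset_between_act -[in RHS](lcoset_reprK y).
by rewrite dcoset_betweenE.
Qed.

Lemma hecke_carrier_smul f g : carrier HA f -> carrier HA g ->
  carrier HA (smul f g).
Proof.
move=> ff fg; pose o := lcoset H 1%g.
apply: (@sub_finite_set _ _ (dcb o @`
  \bigcup_(y in [set y | f (dcb o y) != 0]) [set z | g (dcb y z) != 0])).
  move=> D /= fgD.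
  have DE : dcb o (lcoset H (repr D)) = D.
    by rewrite dcoset_betweenE invg1 mul1g dcoset_reprK.
  exists (lcoset H (repr D)) => //.
  apply: contrapT => no_y; apply: fgD.
  rewrite -[D]DE; apply: etrans (hecke_smulE _ _ _ _) _; apply: fsbig1 => y _.
  have [->|fy] := eqVneq (f (dcb o y)) 0; first by rewrite mul0r.
  have [->|gy] := eqVneq (g (dcb y (lcoset H (repr D)))) 0;
    first by rewrite mulr0.
  by case: no_y; exists y.
apply: finite_image; apply: bigcup_finite => [|y _]; exact: hecke_row_finite.
Qed.

Section RegularRepresentation.
Variables (W : lmodType C) (S : hilbert R) (j : lcosets H -> W -> S) (q : W ->
  W -> C).
Hypothesis j_lin : forall x, linear (j x).
Hypothesis j_orth : forall x y v w,
  inner (j x v) (j y w) = (x == y)%:R * q v w.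
Hypothesis j_total : dense (lspan [set z | exists x v, z = j x v]).

(** Finite columns give the formula a meaning on each slot, and the row and column bounds make it a
    bounded operator. The algebraic laws are then finite matrix computations on the slots. *)
Lemma hecke_right_regular : exists rho : HA -> S -> S,
  hecke_rep rho /\ forall f y v, carrier HA f ->
    rho f (j y v) = \sum_(x \in [set: lcosets H]) f (dcb x y) *: j x v.
Proof.
have /choice[rho rhoP] : forall f, exists T : S -> S, carrier HA f ->
    bounded_operator T /\
    forall y v, T (j y v) = \sum_(x \in [set: lcosets H]) f (dcb x y) *: j x v.
  (* Off the carrier no law is imposed; [id] is a default value. *)
  move=> f; have [ff|] := pselect (carrier HA f); last by exists id.
  have [c c0 cP] := hecke_row_bound ff; have [d d0 dP] := hecke_col_bound ff.
  (* The Schur test takes a single constant, and [c + d] bounds rows and columns alike. *)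
  have [T TP] := @schur_operator R _ W S j q j_lin j_orth
    (fun x y => f (dcb x y)) (c + d) (addr_gt0 c0 d0)
    (fun x r ur => le_trans (cP x r ur) (ler_wpDr (ltW d0) (lexx _)))
    (fun y r ur => le_trans (dP y r ur) (ler_wpDl (ltW c0) (lexx _)))
    j_total (fun y => hecke_col_finite y ff).
  by exists T.
have rhob f (ff : carrier HA f) := (rhoP f ff).1.
have rhoE f y v (ff : carrier HA f) := (rhoP f ff).2 y v.
exists rho; split; last by move=> f y v ff; apply: rhoE.
split; first split=> //.
- move=> c f g v ff fg; have fcg := hecke_carrier_axpy c ff fg.
  apply: (bounded_eq_total j_total (rhob _ fcg)
    (bounded_axpy c (rhob _ ff) (rhob _ fg))) => _ [y [w ->]].
  have [r r_uniq rP] := hecke_col_seq [:: y] ff.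
  have [s s_uniq sP] := hecke_col_seq [:: y] fg.
  have fr x : x \notin undup (r ++ s) -> f (dcb x y) = 0.
    by rewrite mem_undup mem_cat negb_or => /andP[xr _]; apply: rP;
      rewrite ?inE.
  have gs x : x \notin undup (r ++ s) -> g (dcb x y) = 0.
    by rewrite mem_undup mem_cat negb_or => /andP[_ xs]; apply: sP;
      rewrite ?inE.
  rewrite !rhoE// !(@fsumT_seq _ _ (undup (r ++ s))) ?undup_uniq//.
  + rewrite scaler_sumr -big_split /=; apply: eq_bigr => x _.
    by rewrite scalerA -scalerDl.
  + by move=> x xr; rewrite gs// scale0r.
  + by move=> x xr; rewrite fr// scale0r.
  + move=> x xr; rewrite -[_ (dcb x y)]/(c * f (dcb x y) + g (dcb x y)).
    by rewrite fr// gs// mulr0 addr0 scale0r.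
- move=> f g v ff fg; have ffg := hecke_carrier_smul ff fg.
  apply: (bounded_eq_total j_total (rhob _ ffg)
    (bounded_comp (rhob _ ff) (rhob _ fg))) => _ [y [w ->]].
  rewrite -[RHS]/(rho f (rho g (j y w))).
  have [r r_uniq rP] := hecke_col_seq [:: y] fg.
  have [s s_uniq sP] := hecke_col_seq r ff.
  have gr x : x \notin r -> g (dcb x y) = 0 by apply: rP; rewrite inE.
  have fgE x : smul f g (dcb x y) = \sum_(z <- r) f (dcb x z) * g (dcb z y).
    by rewrite hecke_smulE; apply: fsumT_seq => // z zr; rewrite gr// mulr0.
  rewrite !rhoE// (fsumT_seq (r := s))//; last first.
    move=> x xs; rewrite fgE big_seq big1 ?scale0r// => z zr.
    by rewrite sP// mul0r.
  rewrite (fsumT_seq (r := r))//; last by move=> x xr; rewrite gr// scale0r.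
  rewrite (linear_prop_sum (rhob _ ff).1).
  under eq_bigr do rewrite fgE scaler_suml.
  rewrite exchange_big /=; apply: eq_big_seq => z zr.
  rewrite (linear_propZ (rhob _ ff).1) rhoE//.
  rewrite (fsumT_seq (r := s))//; last by move=> x xs; rewrite sP// scale0r.
  by rewrite scaler_sumr; apply: eq_bigr => x _; rewrite scalerA mulrC.
- move=> f v w ff; have ffs := hecke_carrier_star ff.
  apply: (adjoint_total (rhob _ ffs) (rhob _ ff) j_total j_total).
  move=> _ _ [y [{}v ->]] [z [{}w ->]].
  have [r r_uniq rP] := hecke_col_seq [:: y] ffs.
  have [s s_uniq sP] := hecke_col_seq [:: z] ff.
  rewrite !rhoE//.
  rewrite (@fsumT_seq _ _ (undup (z :: r))) ?undup_uniq//; last first.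
    move=> x; rewrite mem_undup inE negb_or => /andP[_ xr].
    by rewrite rP ?inE// scale0r.
  rewrite (@fsumT_seq _ _ (undup (y :: s))) ?undup_uniq//; last first.
    move=> x; rewrite mem_undup inE negb_or => /andP[_ xs].
    by rewrite sP ?inE// scale0r.
  rewrite inner_suml inner_sumr.
  rewrite (bigD1_seq z) ?undup_uniq ?mem_undup ?inE ?eqxx// big1 => [|x xz];
    last first.
    by rewrite innerZl j_orth (negPf xz) mul0r mulr0.
  rewrite (bigD1_seq y) ?undup_uniq ?mem_undup ?inE ?eqxx// big1 => [|x xy];
    last first.
    by rewrite innerZr j_orth eq_sym (negPf xy) mul0r mulr0.
  by rewrite innerZl innerZr !j_orth !eqxx hecke_sstarE.
- move=> v; have f1 := hecke_char_carrier 1%g.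
  apply: (bounded_eq_total j_total (rhob _ f1) (@bounded_id _ _)) =>
    _ [y [w ->]].
  rewrite rhoE// (@fsumT_seq _ _ [:: y])//.
    by rewrite big_seq1 dcoset_between_id /hecke_char /pointmass eqxx scale1r.
  move=> x; rewrite inE => xy; rewrite /hecke_char /pointmass.
  case: eqP => [|_]; last by rewrite scale0r.
  by move=> /dcoset_between_eq1 xy'; case/eqP: xy.
Qed.

End RegularRepresentation.
End HeckeAlgebra.

(** * Covariance of the matrix representation *)

Section RegularCovariance.
Variables (R : realType) (G : groupType) (H : groupClosed G).
Hypothesis hH : hecke_pair H.
Local Notation C := R[i].
Local Notation HA := (hecke_algebra H R).
Local Notation c0 := (c0 R (lcosets H)).
Local Notation dcb := (@dcoset_between G H).
Variables (W : lmodType C) (S : hilbert R) (j : lcosets H -> W -> S).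
Hypothesis j_total : dense (lspan [set z | exists x v, z = j x v]).
Variables (rho : HA -> S -> S) (nu : c0 -> S -> S).
Hypothesis rho_rep : star_rep rho.
Hypothesis rhoE : forall f y v, carrier HA f ->
  rho f (j y v) = \sum_(x \in [set: lcosets H]) f (dcb x y) *: j x v.
Hypothesis nu_rep : star_rep nu.
Hypothesis nuE : forall f y v, carrier c0 f -> nu f (j y v) = f y *: j y v.

Lemma regular_pointmass x f y v : carrier HA f ->
  nu (pointmass R x) (rho f (j y v)) = f (dcb x y) *: j x v.
Proof.
move=> ff; have [nub _ _ _] := nu_rep.
have [r r_uniq rP] := hecke_col_seq hH [:: y] ff.
rewrite rhoE// (@fsumT_seq _ _ (undup (x :: r))) ?undup_uniq//; last first.
  move=> z; rewrite mem_undup inE negb_or => /andP[_ zr].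
  by rewrite rP ?inE// scale0r.
rewrite (linear_prop_sum (nub _ (c0_pointmass _)).1).
rewrite (bigD1_seq x) ?undup_uniq ?mem_undup ?inE ?eqxx// big1 => [|z zx].
  rewrite [LHS]addr0 (linear_propZ (nub _ (c0_pointmass _)).1) nuE//;
    last exact: c0_pointmass.
  by rewrite /pointmass eqxx scale1r.
rewrite (linear_propZ (nub _ (c0_pointmass _)).1) nuE//;
  last exact: c0_pointmass.
by rewrite /pointmass (negPf zx) scale0r scaler0.
Qed.

(** On the slot [z] both sides are the sum of the slots [g u] over the [u] in [H a^-1 H], times the
    indicator that [X] and [z] are in relative position [HbH]. On the right, the inner point mass
    selects [v = g^-1 z], and the outer one selects a matrix entry equal to 1. *)
Lemma regular_covariant : covariant_pair nu rho.
Proof.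
move=> a g b k; set X := lcoset H g.
have [nub _ _ _] := nu_rep; have [rhob _ _ _] := rho_rep.
have [sa [sa_uniq saP saE]] := @fsum_seq _ S _ (hH (dcoset H a^-1%g)).
have [sb [sb_uniq sbP sbE]] := @fsum_seq _ S _ (hH (dcoset H b)).
have charP c := @hecke_char_carrier R G H c.
have pmP x := @c0_pointmass R (lcosets H) x.
pose lhs k' :=
  rho (hecke_char H R a) (nu (pointmass R X) (rho (hecke_char H R b) k')).
(* Finite lists present the right-hand side as a sum of bounded operators, so that both sides can be
   compared on slots. *)
pose rhs k' := \sum_(p <- sa)
  \sum_(v <- sb)
  nu (pointmass R (lcoset_act g p))
    (rho (hecke_char H R ((repr p)^-1 * repr v)%g)
      (nu (pointmass R (lcoset_act g v)) k')).
have rhsE k' : rhs k' = \sum_(p \in lcosets_in (dcoset H a^-1%g))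
    \sum_(v \in lcosets_in (dcoset H b)) nu (pointmass R (lcoset_act g p))
      (rho (hecke_char H R ((repr p)^-1 * repr v)%g)
      (nu (pointmass R (lcoset_act g v)) k')).
  by rewrite saE; apply: eq_bigr => p _; rewrite sbE.
rewrite -rhsE -/(lhs k); move: k.
have lhs_b : bounded_operator lhs.
  exact: (bounded_comp (rhob _ (charP a))
    (bounded_comp (nub _ (pmP X)) (rhob _ (charP b)))).
have rhs_b : bounded_operator rhs.
  apply: bounded_sum => p; apply: bounded_sum => v.
  exact: (bounded_comp (nub _ (pmP (lcoset_act g p)))
    (bounded_comp (rhob _ (charP _)) (nub _ (pmP (lcoset_act g v))))).
apply: (bounded_eq_total j_total lhs_b rhs_b) => _ [z [w ->]].
pose v0 := lcoset_act g^-1%g z.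
have XE : X = lcoset_act g (lcoset H 1%g) by rewrite lcoset_actE mulg1.
have zE : z = lcoset_act g v0 by rewrite lcoset_actKV.
have XzE : dcb X z = dcoset H (repr v0).
  by rewrite XE zE dcoset_between_act dcoset_between1.
rewrite /lhs regular_pointmass// (linear_propZ (rhob _ (charP a)).1).
have inner_sum p : \sum_(v <- sb)
    nu (pointmass R (lcoset_act g p))
     (rho (hecke_char H R ((repr p)^-1 * repr v)%g)
      (nu (pointmass R (lcoset_act g v)) (j z w)))
   = hecke_char H R b (dcb X z) *: j (lcoset_act g p) w.
  have term v : nu (pointmass R (lcoset_act g p))
     (rho (hecke_char H R ((repr p)^-1 * repr v)%g)
      (nu (pointmass R (lcoset_act g v)) (j z w)))
      = (v == v0)%:R *: j (lcoset_act g p) w.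
    rewrite nuE// (linear_propZ (rhob _ (charP _)).1).
    rewrite (linear_propZ (nub _ (pmP _)).1) regular_pointmass// {1}/pointmass
      zE.
    rewrite (inj_eq (can_inj (lcoset_actK g))) eq_sym dcoset_between_act.
    case: eqVneq => [->|_]; last by rewrite !scale0r.
    by rewrite scale1r /hecke_char /pointmass eqxx.
  rewrite (eq_bigr _ (fun v _ => term v)) -scaler_suml; congr (_ *: _).
  rewrite XzE /hecke_char /pointmass -natr_sum.
  have vin : (v0 \in sb) = (dcoset H (repr v0) == dcoset H b).
    by apply/idP/eqP => [/sbP/lcosets_inP//|/lcosets_inP/sbP].
  rewrite -vin; case: (boolP (v0 \in _)) => v0in.
    by rewrite (bigD1_seq v0)// eqxx big1 ?addr0// => v /negPf->.
  rewrite big_seq big1// => v vin'; case: eqVneq => // vv0.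
  by case/negP: v0in; rewrite -vv0.
rewrite /rhs (eq_bigr _ (fun p _ => inner_sum p)) -scaler_sumr; congr (_ *: _).
rewrite rhoE// (@fsumT_seq _ _ [seq lcoset_act g p | p <- sa]).
- rewrite big_map; apply: eq_big_seq => p.
  move=> /saP/lcosets_inP pa.
  rewrite XE dcoset_between_act dcoset_between_sym dcoset_between1 pa
    dcoset_invE invgK.
  by rewrite /hecke_char /pointmass eqxx scale1r.
- by rewrite map_inj_uniq//; apply: can_inj (lcoset_actK g).
move=> y yn; rewrite /hecke_char /pointmass; case: eqP => [yX|_];
  last by rewrite scale0r.
case/negP: yn; rewrite -(lcoset_actKV g y); apply: map_f.
apply/saP/lcosets_inP.
rewrite -dcoset_between1 dcoset_between_sym -dcoset_invE -yX; congr dcoset_inv.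
by rewrite XE -{2}[y](lcoset_actKV g) dcoset_between_act.
Qed.

End RegularCovariance.

(** * Regular representations carry a covariant pair *)

Section Transport.
Variable R : realType.
Local Notation C := R[i].

Lemma bounded_closure_span (K L : normedModType C) (S : set K) (S' : set L)
    (T : K -> L) : bounded_operator T -> dense (lspan S) ->
  (forall v, S v -> closure_span S' (T v)) -> forall v, closure_span S' (T v).
Proof.
move=> /bounded_operatorP[Tlin [M M0 TM]] dS SS'.
apply: (dense_lspan_min (P := [set v | closure_span S' (T v)]) dS) => //.
- split=> [|a x y /= Tx Ty].
    by rewrite /= linear_prop0//; apply: (closure_span_linear S').1.
  by rewrite /= Tlin; apply: (closure_span_linear S').2.
move=> v Tv /=; apply: closure_span_closed => e e0.
have [w Tw vw] := Tv _ (divr_gt0 e0 M0); exists (T w) => //.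
rewrite -(linear_propB Tlin); apply: le_lt_trans (TM _) _.
by rewrite -ltr_pdivlMl// mulrC.
Qed.

Lemma unitary_bounded (K L : hilbert R) (U : K -> L) : unitary U ->
  bounded_operator U.
Proof.
move=> [Ulin Uinner _]; split=> //; exists 1 => v.
by rewrite mul1r -(@ler_pXn2r _ 2) ?nnegrE// !inner_norm Uinner.
Qed.

Lemma unitary_inverse (K L : hilbert R) (U : K -> L) : unitary U ->
  exists2 U' : L -> K, unitary U' & cancel U U' /\ cancel U' U.
Proof.
move=> U_unit; have [Ulin Uinner /choice[U' U'K]] := U_unit.
have U_inj v w : U v = U w -> v = w.
  move=> vw; apply/eqP; rewrite -subr_eq0; apply/eqP/inner_eq0.
  by rewrite -Uinner (linear_propB Ulin) vw subrr inner0l.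
have UK : cancel U U' by move=> v; apply: U_inj; rewrite U'K.
exists U'; last by split=> // w; rewrite U'K.
split=> [a x y|v w|v]; last by exists (U v); rewrite UK.
  by apply: U_inj; rewrite Ulin !U'K.
by rewrite -Uinner !U'K.
Qed.

Lemma tensor_norm (K L T : hilbert R) (t : K -> L -> T) v w :
  hilbert_tensor t -> `|t v w| = `|v| * `|w|.
Proof.
move=> [_ _ t_inner _]; apply/eqP; rewrite -(@eqrXn2 _ 2) ?mulr_ge0// exprMn.
by rewrite !inner_norm t_inner.
Qed.

Lemma tensor_bounded_l (K L T : hilbert R) (t : K -> L -> T) w :
  hilbert_tensor t -> bounded_operator (t ^~ w).
Proof.
move=> tt; have [_ t_lin _ _] := tt; split; first exact: t_lin.
by exists `|w| => v; rewrite (tensor_norm _ _ tt) mulrC.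
Qed.

Lemma tensor_bounded_r (K L T : hilbert R) (t : K -> L -> T) v :
  hilbert_tensor t -> bounded_operator (t v).
Proof.
move=> tt; have [t_lin _ _ _] := tt; split; first exact: t_lin.
by exists `|v| => w; rewrite (tensor_norm _ _ tt).
Qed.

Lemma tensor_total (K L T : hilbert R) (t : K -> L -> T) (S : set L) :
  hilbert_tensor t -> dense (lspan S) ->
  dense (lspan [set z | exists v w, S w /\ z = t v w]).
Proof.
move=> tt dS; have [_ _ _ dt] := tt; apply: dense_lspan_trans dt _.
move=> _ [v [w ->]]; apply: (bounded_closure_span (tensor_bounded_r v tt) dS).
by move=> {}w Sw; apply: sub_closure_span; exists v, w.
Qed.

End Transport.

(** * From regularity to a covariant pair *)

Section RegularImpliesCovariant.
Variables (R : realType) (G : groupType) (H : groupClosed G).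
Variables (A B T : cstar_algebra R) (u : G -> A) (t : B -> A -> T) (delta : B ->
  T).
Variables (X : cstar_algebra R) (iota : gsections u t delta H -> X).
Variables (L : hilbert R) (e : lcosets H -> L).
Hypotheses (hmax : maximal u t delta) (hH : hecke_pair H) (hL : l2_space e).
Variables (K : hilbert R) (pi : cstar_alg B -> K -> K).
Variables (nu : c0 R (lcosets H) -> K -> K) (Phi : cstar_alg X -> K -> K).
Hypotheses (hpinu : covariant_rep u t delta pi nu).
Hypothesis hPhi : integrated_form iota pi nu Phi.
Local Notation C := R[i].
Local Notation HA := (hecke_algebra H R).

Lemma spectral_total : dense (lspan [set b | exists x, spectral u t delta x b]).
Proof.
have [_ dsec _] := hmax; apply/denseP => b r r0.
have /denseP/(_ b r r0)[_ [f [fspec ffin] <-] bf] := dsec.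
exists (\sum_(x \in [set: G]) f x) => //; rewrite /finite_support.
apply: linear_set_sum => [|x]; first exact: lspan_linear.
by apply: sub_lspan; exists x; apply: fspec.
Qed.

(** Only products of [pi b] with point masses are known to be intertwined. Sums of these give finite
    indicators, which tend strongly to 1 on both spaces; no relation between [U] and [nu] is
    presupposed. *)
Lemma integrated_form_limit (S : hilbert R) (U : K -> S) (b : B)
    (Theta_b : S -> S) (oneM : c0 R (lcosets H) -> S -> S) :
    bounded_operator U -> bounded_operator Theta_b -> representation oneM ->
    (forall y v, U (pi b (nu (pointmass R y) v))
      = Theta_b (oneM (pointmass R y) (U v))) ->
  forall v, U (pi b v) = Theta_b (U v).
Proof.
move=> Ub Thb oneM_rep eqUTh v.
have [[pi_star _] nu_rep _] := hpinu; have [pib _ _ _] := pi_star.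
have /bounded_operatorP[Tlin [M M0 TM]] := bounded_comp Ub (pib b Logic.I).
have /bounded_operatorP[Thlin [N N0 ThN]] := Thb.
apply/eqP; rewrite -subr_eq0; apply/eqP/norm_le_small => d d0.
have [r rP] := c0_rep_approx nu_rep v (divr_gt0 (divr_gt0 d0 (ltr0Sn _ 1)) M0).
have [s sP] := c0_rep_approx oneM_rep (U v) (divr_gt0 (divr_gt0 d0 (ltr0Sn _ 1))
  N0).
(* One finite set that serves the approximations in both spaces. *)
pose p := undup (r ++ s); have p_uniq : uniq p by exact: undup_uniq.
have {}rP : `|v - nu (finite_indicator R p) v| < d / 2 / M.
  by apply: rP => y yr; rewrite mem_undup mem_cat yr.
have {}sP : `|U v - oneM (finite_indicator R p) (U v)| < d / 2 / N.
  by apply: sP => y ys; rewrite mem_undup mem_cat ys orbT.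
have E : U (pi b (nu (finite_indicator R p) v))
    = Theta_b (oneM (finite_indicator R p) (U v)).
  rewrite !c0_rep_finite_indicator// (linear_prop_sum (pib b Logic.I).1).
  rewrite (linear_prop_sum Ub.1) (linear_prop_sum Thlin).
  by apply: eq_bigr => y _; apply: eqUTh.
rewrite -(subrKA (U (pi b (nu (finite_indicator R p) v)))) {2}E.
rewrite -[U (pi b v)]/((U \o pi b) v) -[U (pi b _)]/((U \o pi b) _).
rewrite -(linear_propB Tlin) -(linear_propB Thlin) [d]splitr.
apply: le_trans (ler_normD _ _) _; apply: lerD.
  by apply: le_trans (TM _) _; rewrite -ler_pdivlMl// mulrC ltW.
by apply: le_trans (ThN _) _; rewrite -ler_pdivlMl// mulrC distrC ltW.
Qed.

Lemma regular_implies_covariant :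
  (exists (S : hilbert R) (Psi : cstar_alg X -> S -> S),
      regular iota e Psi /\ unitarily_equivalent Phi Psi) ->
  exists V : HA -> K -> K,
      [/\ hecke_rep V, covariant_pair nu V
        & forall (f : HA) (b : B) (v : K),
            carrier HA f -> V f (pi b v) = pi b (V f v)].
Proof.
move=> [S [Psi [[K0 [theta [s [theta_rep s_tensor reg]]]] [U [U_unit UPhi]]]]].
have [lambda [Th [M [oneM]]]] := reg.
move=> [[lambda_rep lambdaE] [Th_rep ThE] [M_rep ME] [oneM_rep oneME] [_ PsiE]].
have [_ PhiE] := hPhi; have [pi_rep nu_rep pinu] := hpinu.
have [U' U'_unit [UK U'K]] := unitary_inverse U_unit.
have Ub := unitary_bounded U_unit; have Ub' := unitary_bounded U'_unit.
have [[pib _ piM piV] pi_nd] := pi_rep.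
have [[Thb _ _ _] _] := Th_rep.
have [e_orth e_total] := hL; have [_ s_lin s_inner _] := s_tensor.
pose j x v := s v (e x).
have j_lin x : linear (j x) by exact: s_lin.
have j_orth x y v w : inner (j x v) (j y w) = (x == y)%:R * inner v w.
  by rewrite s_inner e_orth mulrC.
have j_total : dense (lspan [set z | exists x v, z = j x v]).
  apply: dense_lspan_trans (tensor_total s_tensor e_total) _.
  by move=> _ [v [_ [[x _ <-] ->]]]; apply: sub_closure_span; exists x, v.
have [rho [rho_rep rhoE]] := hecke_right_regular hH j_lin j_orth j_total.
have [[rhob rhoZD rhoM rhoV] rho1] := rho_rep.
have UPi x b v : spectral u t delta x b -> U (pi b v) = Th (delta b) (U v).
  move=> bx; apply: (integrated_form_limit Ub (Thb (delta b) Logic.I) oneM_rep).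
  by move=> y w; rewrite -(PhiE _ _ _ _ bx) UPhi// (PsiE _ _ _ _ bx).
(* Every spectral [b], hence every [b], annihilates the pulled-back difference, and a nondegenerate
   [pi] has no common null vector. *)
have Unu y v : U (nu (pointmass R y) v) = oneM (pointmass R y) (U v).
  apply/eqP; rewrite -subr_eq0; apply/eqP.
  set w := U _ - _; rewrite -(U'K w).
  suff -> : U' w = 0 by rewrite (linear_prop0 Ub.1).
  have pi_w b : pi b (U' w) = 0.
    apply: (bounded_eq_total spectral_total
      (cstar_rep_bounded_operator _ pi_rep.1) (@bounded_zero _ _ _)) =>
        {}b [x bx].
    rewrite -(UK (pi b _)) (UPi x)// U'K (linear_propB (Thb (delta b)
      Logic.I).1).
    rewrite -(UPi x)// -(PhiE _ _ _ _ bx) UPhi// (PsiE _ _ _ _ bx) subrr.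
    exact: (linear_prop0 Ub'.1).
  apply: (inner_total pi_nd) => _ [b [v' [_ ->]]].
  by rewrite -piV// pi_w !inner0l.
have oneM_j f y v : carrier (c0 R (lcosets H)) f ->
  oneM f (j y v) = f y *: j y v.
  move=> f0; rewrite oneME// ME//.
  by rewrite (linear_propZ (tensor_bounded_r v s_tensor).1).
have rho_cov := regular_covariant hH j_total rho_rep.1 rhoE oneM_rep.1 oneM_j.
(* A spectral [b] of degree [x] translates slots by [x], and the matrix entries of [f] are invariant
   under this translation. *)
have rho_Theta f x b v : carrier HA f -> spectral u t delta x b ->
    rho f (Th (delta b) v) = Th (delta b) (rho f v).
  move=> ff bx; apply: (bounded_eq_total j_total
    (bounded_comp (rhob _ ff) (Thb (delta b) Logic.I))
    (bounded_comp (Thb (delta b) Logic.I) (rhob _ ff))) => _ [y [w ->]].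
  have Thj z w' : Th (delta b) (j z w') = j (lcoset_act x z) (theta b w').
    by rewrite bx ThE lambdaE.
  rewrite /= Thj !rhoE//.
  have x_bij : bijective (@lcoset_act _ H x).
    by exists (lcoset_act x^-1%g); [exact: lcoset_actK | exact: lcoset_actKV].
  rewrite (reindex_fsbigT (lcoset_act x) _ x_bij).
  have [r r_uniq rP] := hecke_col_seq hH [:: y] ff.
  have fr z : z \notin r -> f (dcoset_between z y) = 0 by apply: rP;
    rewrite inE.
  rewrite !(fsumT_seq r_uniq); last 2 first.
  - by move=> z zr; rewrite fr// scale0r.
  - by move=> z zr; rewrite dcoset_between_act fr// scale0r.
  rewrite (linear_prop_sum (Thb (delta b) Logic.I).1); apply: eq_bigr => z _.
  by rewrite (linear_propZ (Thb (delta b) Logic.I).1) Thj dcoset_between_act.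
exists (fun f v => U' (rho f (U v))); split.
- split; first split.
  + move=> f ff; exact: (bounded_comp Ub' (bounded_comp (rhob _ ff) Ub)).
  + by move=> z f g v ff fg; rewrite rhoZD// Ub'.1.
  + by move=> f g v ff fg; rewrite rhoM// U'K.
  + move=> f v w ff; have [_ Uin _] := U_unit.
    by rewrite -Uin U'K rhoV// -[RHS]Uin U'K.
  + by move=> v; rewrite rho1 UK.
- move=> a x b v; rewrite Unu !U'K rho_cov.
  rewrite linear_prop_fsum; [|exact: Ub'.1|exact: hH].
  apply: eq_fsbigr => p _.
  rewrite linear_prop_fsum; [|exact: Ub'.1|exact: hH].
  apply: eq_fsbigr => q _.
  by rewrite Unu -[nu _ (U' _)]UK Unu U'K.
- move=> f b v ff; move: b.
  apply: (bounded_eq_total spectral_total).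
  + apply: (bounded_comp (T := U' \o rho f \o U) (U := fun b : B => pi b v)).
      exact: (bounded_comp (bounded_comp Ub' (rhob _ ff)) Ub).
    exact: cstar_rep_bounded_operator pi_rep.1.
  + exact: cstar_rep_bounded_operator pi_rep.1.
  + move=> b [x bx] /=;
    rewrite (UPi x)// (rho_Theta f x)// -{1}(U'K (rho f (U v))).
    by rewrite -(UPi x)// UK.
Qed.

End RegularImpliesCovariant.

(** * Tensor products of representations *)

Section TensorRepresentation.
Variable R : realType.
Local Notation C := R[i].

(** Replaces the crude constant that comes with boundedness by the one valid on a dense set. *)
Lemma bounded_norm_dense (V W : normedModType C) (P : set V) (T : V -> W) (N :
  C) :
  bounded_operator T -> dense P -> 0 <= N ->
  (forall v, P v -> `|T v| <= N * `|v|) -> forall v, `|T v| <= N * `|v|.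
Proof.
move=> /bounded_operatorP[Tlin [M M0 TM]] /denseP dP N0 PN v.
rewrite -subr_le0; apply/negPn/negP.
have real_diff : `|T v| - N * `|v| \is Num.real.
  by rewrite rpredB ?rpredM ?normr_real// ger0_real.
rewrite -real_ltNge ?real0// => gap.
have MN0 : 0 < M + N by rewrite ltr_pwDl.
have [w Pw vw] := dP v _ (divr_gt0 gap MN0).
suff : `|T v| < `|T v| by rewrite ltxx.
have -> : T v = T w + T (v - w) by rewrite -(linear_propD Tlin) addrC subrK.
apply: le_lt_trans (ler_normD _ _) _.
rewrite -(linear_propD Tlin) [w + _]addrC subrK.
have w_le : `|w| <= `|v| + `|v - w|.
  by rewrite -{1}(subrKC v w) -(distrC w) ler_normD.
apply: (@le_lt_trans _ _ (N * `|v| + (M + N) * `|v - w|)).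
  have -> : N * `|v| + (M + N) * `|v - w| = N * (`|v| + `|v - w|) + M * `|v -
    w|.
    by ring.
  apply: lerD (TM _); apply: le_trans (PN _ Pw) _.
  by rewrite ler_wpM2l.
by rewrite -ltrBrDl mulrC -ltr_pdivlMr.
Qed.

Variables (A B T : cstar_algebra R) (t : B -> A -> T).
Hypothesis tT : min_tensor t.
Variables (K L M : hilbert R) (m : K -> L -> M).
Variables (theta : cstar_alg B -> K -> K) (lambda : cstar_alg A -> L -> L).
Hypotheses (m_tensor : hilbert_tensor m).
Hypotheses (theta_rep : representation theta) (lambda_rep :
  representation lambda).

Let m_linl w : linear (m ^~ w). Proof. by case: m_tensor. Qed.
Let m_dense : dense (lspan [set z | exists v w, z = m v w]).
Proof. by case: m_tensor. Qed.
Let theta_b b : bounded_operator (theta b).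
Proof. by case: theta_rep => -[+ _ _ _] _; apply. Qed.

Let tensor_bound n (b : 'I_n -> B) (a : 'I_n -> A) p (v : 'I_p -> K) (w :
  'I_p -> L) :
  `|\sum_i \sum_j m (theta (b i) (v j)) (lambda (a i) (w j))|
    <= `|\sum_i t (b i) (a i)| * `|\sum_j m (v j) (w j)|.
Proof.
have [_ _ _ _ bound] := tT.
exact: (bound n b a _ (normr_ge0 _)).1 (lexx _) _ _ _ m theta lambda m_tensor
  theta_rep lambda_rep p v w.
Qed.

Lemma tensor_operator (b : B) (a : A) : exists D : M -> M,
  bounded_operator D /\ forall v w, D (m v w) = m (theta b v) (lambda a w).
Proof.
pose g (p : K * L) := m p.1 p.2.
pose g' (p : K * L) := m (theta b p.1) (lambda a p.2).
have g_dense : dense (lspan (range g)).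
  apply: dense_lspan_trans m_dense _ => _ [v [w ->]].
  by apply: sub_closure_span; exists (v, w).
have N0 : 0 < `|t b a| + 1 by rewrite ltr_wpDl.
have [n c k|D [Dlin DM Dg]] := bounded_extension_family N0 _ g_dense (g' := g').
  have := @tensor_bound 1 (fun=> b) (fun=> a) n (fun j =>
    c j *: (k j).1) (fun j => (k j).2).
  rewrite !big_ord1.
  under eq_bigr do rewrite (linear_propZ (theta_b b).1) (linear_propZ
    (m_linl _)).
  under [X in _ * `|X|]eq_bigr do rewrite (linear_propZ (m_linl _)).
  move=> /le_trans; apply; rewrite ler_wpM2r//.
  by rewrite lerDl.
exists D; split; first by split=> //; exists (`|t b a| + 1).
by move=> v w; rewrite -[m v w]/(g (v, w)) Dg.
Qed.

(** The extension takes two stages: each [theta(b) (x) lambda(a)] extends from elementary vectors to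
    an operator [D (b, a)] on [M]; then, for each vector [xi], the assignment
    [t b a |-> D (b, a) xi] extends to [T]. The norm clause of [min_tensor] bounds both. *)
Lemma tensor_representation : exists Th : cstar_alg T -> M -> M,
  representation Th /\
  forall b a v w, Th (t b a) (m v w) = m (theta b v) (lambda a w).
Proof.
have [[t_linr t_linl] tM tstar t_dense _] := tT.
have [[_ thetaZD thetaM thetaV] theta_nd] := theta_rep.
have [[_ lambdaZD lambdaM lambdaV] lambda_nd] := lambda_rep.
have /choice[D DP] : forall p : B * A, exists D : M -> M, bounded_operator D /\
    forall v w, D (m v w) = m (theta p.1 v) (lambda p.2 w).
  by move=> [b a]; apply: tensor_operator.
have Db p := (DP p).1; have DE p v w : D p (m v w) = _ := (DP p).2 v w.
pose g (p : B * A) := t p.1 p.2.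
have g_dense : dense (lspan (range g)).
  apply: dense_lspan_trans t_dense _ => _ [b [a ->]].
  by apply: sub_closure_span; exists (b, a).
(* The norm clause covers finite sums of elementary vectors; density carries it to all [xi] with the
   same constant. *)
have D_bound n (c : 'I_n -> C) (k : 'I_n -> B * A) xi :
    `|\sum_i c i *: D (k i) xi| <= `|\sum_i c i *: g (k i)| * `|xi|.
  have sum_b : bounded_operator (fun xi => \sum_i c i *: D (k i) xi).
    apply: (@bounded_sum _ _ _ _ _ (fun i xi => c i *: D (k i) xi)) => i.
    have := bounded_axpy (c i) (Db (k i)) (@bounded_zero _ M M).
    by under eq_fun do rewrite addr0.
  move: xi; apply: (bounded_norm_dense sum_b m_dense) =>
    // _ [p [d [z [zm ->]]]].
  have /choice[v /choice[w zE]] := zm.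
  have := @tensor_bound n (fun i => c i *: (k i).1) (fun i => (k i).2) p
    (fun j => d j *: v j) w.
  have -> : \sum_i t (c i *: (k i).1) (k i).2 = \sum_i c i *: g (k i).
    by apply: eq_bigr => i _; rewrite (linear_propZ (t_linl _)).
  have -> : \sum_j m (d j *: v j) (w j) = \sum_i d i *: z i.
    by apply: eq_bigr => j _; rewrite (linear_propZ (m_linl _)) zE.
  suff -> : \sum_i \sum_j m (theta (c i *: (k i).1) (d j *: v j))
    (lambda (k i).2 (w j))
      = \sum_i c i *: D (k i) (\sum_j d j *: z j) by [].
  apply: eq_bigr => i _; rewrite (linear_prop_sum (Db _).1) scaler_sumr.
  apply: eq_bigr => j _;
    rewrite (linear_propZ (theta_b _).1) (linear_propZ (m_linl _)).
  rewrite (star_repZ theta_rep.1)// (linear_propZ (m_linl _)).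
  by rewrite (linear_propZ (Db _).1) zE DE !scalerA mulrC.
have /choice[Th' Th'P] : forall xi, exists E : T -> M, [/\ linear E,
    forall z, `|E z| <= (`|xi| + 1) * `|z| & forall p, E (g p) = D p xi].
  move=> xi; have xi0 : 0 < `|xi| + 1 by rewrite ltr_wpDl.
  apply: (bounded_extension_family xi0 _ g_dense) => n c k.
  apply: le_trans (D_bound n c k xi) _.
  by rewrite mulrC ler_wpM2r// lerDl.
pose Th (z : cstar_alg T) xi := Th' xi z.
have ThZ xi : bounded_operator (fun z : T => Th z xi).
  by have [lin bnd _] := Th'P xi; split=> //; exists (`|xi| + 1).
have Th_t p xi : Th (g p) xi = D p xi by rewrite /Th; have [_ _ ->] := Th'P xi.
have Th_norm z xi : `|Th z xi| <= (`|xi| + 1) * `|z| by have [_ + _] := Th'P xi;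
  apply.
have Th_lin z : linear (Th z).
  move=> a xi eta; have := bounded_eq_total g_dense (ThZ (a *: xi + eta))
    (bounded_axpy a (ThZ xi) (ThZ eta)); apply=> _ [p _ <-].
  by rewrite !Th_t (Db p).1.
have Th_b z : bounded_operator (Th z).
  split=> //; exists (2 * `|z|) => xi.
  have [->|xi0] := eqVneq xi 0;
    first by rewrite (linear_prop0 (Th_lin z)) !normr0 mulr0.
  have nxi : `|xi| != 0 by rewrite normr_eq0.
  (* The constant [|xi| + 1] of [Th_norm] is not homogeneous; for a unit vector it equals 2. *)
  have xiE : xi = `|xi| *: (`|xi|^-1 *: xi) by rewrite scalerA divff// scale1r.
  rewrite {1}xiE (linear_propZ (Th_lin z)) normrZ.
  rewrite normr_id mulrC ler_wpM2r//; apply: le_trans (Th_norm _ _) _.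
  by rewrite normrZ normfV normr_id mulVf.
have ThM_t p z xi : Th (cmul (g p) z) xi = Th (g p) (Th z xi).
  have cmul_b : bounded_operator (cmul (g p)).
    by split; [exact: cmul_linearr | exists `|g p| => z'; exact: cnormM].
  apply: (bounded_eq_total g_dense (bounded_comp (ThZ xi) cmul_b)
    (bounded_comp (Th_b (g p)) (ThZ xi))) => _ [q _ <-] /=.
  rewrite /g tM -[t _ _]/(g (cmul p.1 q.1, cmul p.2 q.2)) -/(g p) -/(g q) !Th_t.
  apply: (bounded_eq_total m_dense (Db _) (bounded_comp (Db _) (Db _))) =>
    _ [v [w ->]].
  by rewrite /= !DE -thetaM// -lambdaM.
have ThM y z xi : Th (cmul y z) xi = Th y (Th z xi).
  have cmul_b : bounded_operator (cmul ^~ z).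
    split; first exact: cmul_linearl.
    by exists `|z| => y'; rewrite mulrC; exact: cnormM.
  apply: (bounded_eq_total g_dense (bounded_comp (ThZ xi) cmul_b) (ThZ _)) =>
    _ [p _ <-].
  exact: ThM_t.
exists Th; split; last by move=> b a v w; rewrite -[t b a]/(g (b, a)) Th_t DE.
split; first split=> //.
- by move=> z a b v _ _; rewrite (ThZ v).1.
- by move=> a b v _ _; apply: ThM.
- move=> z xi eta _; rewrite inner_conj [RHS]inner_conj; congr Num.conj.
  (* Linear in [z], because the involution and the second argument of [inner] are both antilinear;
     hence elementary tensors suffice. *)
  have h_b : bounded_operator (fun z : T => inner eta (Th (cstar z) xi) : C^o).
    split=> [a x y|].
      by rewrite cstar_conjlinear (ThZ xi).1 innerPr conjCK.
    exists (`|eta| * (`|xi| + 1)) => y; apply: le_trans (cauchy_schwarz _ _) _.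
    by rewrite -mulrA ler_wpM2l// -(cstar_norm y).
  apply: (bounded_eq_total g_dense h_b
    (bounded_comp (inner_bounded xi) (ThZ eta))) => _ [p _ <-] /=.
  rewrite /g tstar -[t (cstar _) _]/(g (cstar p.1, cstar p.2)) -/(g p) !Th_t.
  rewrite inner_conj [RHS]inner_conj; congr Num.conj.
  apply: (adjoint_total (Db _) (Db _) m_dense m_dense) =>
    _ _ [v [w ->]] [v' [w' ->]].
  rewrite !DE; have [_ _ m_inner _] := m_tensor; rewrite !m_inner.
  by rewrite -thetaV// -lambdaV.
apply: dense_lspan_trans m_dense _ => _ [v [w ->]].
apply: (bounded_closure_span (tensor_bounded_l w m_tensor) theta_nd).
move=> _ [b [{}v [_ ->]]].
apply: (bounded_closure_span (tensor_bounded_r _ m_tensor) lambda_nd).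
move=> _ [a [{}w [_ ->]]]; apply: sub_closure_span.
by exists (t b a), (m v w); rewrite -[t b a]/(g (b, a)) Th_t DE.
Qed.

End TensorRepresentation.

(** * Representations on l^2 *)

Section L2Representations.
Variables (R : realType) (I : choiceType) (L : hilbert R) (e : I -> L).
Hypothesis hL : l2_space e.
Local Notation C := R[i].
Local Notation c0 := (c0 R I).

Lemma c0_bounded (f : I -> C) : carrier c0 f ->
  exists2 c : C, 0 < c & forall i, `|f i| <= c.
Proof.
move=> f0; have /finite_seqP[r rE] := f0 1 ltr01.
have sum_ge0 (s : seq I) : 0 <= \sum_(i <- s) `|f i|.
  by apply: sumr_ge0 => i _; apply: normr_ge0.
exists (1 + \sum_(i <- r) `|f i|) => [|i]; first by rewrite ltr_pwDl.
have fi_real : `|f i| \is Num.real by rewrite normr_real.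
have [fi1|fi1] := real_leP (@real1 C) fi_real; last first.
  by apply: le_trans (ltW fi1) _; rewrite lerDl.
have ir : i \in r by have : [set` r] i by rewrite -rE.
apply: (@le_trans _ _ (\sum_(i <- r) `|f i|)); last by rewrite lerDr.
by rewrite (perm_big _ (perm_to_rem ir)) /= big_cons lerDl.
Qed.

Lemma c0_axpy (a : C) (f g : I -> C) : carrier c0 f -> carrier c0 g ->
  carrier c0 (fun i => a * f i + g i).
Proof.
move=> f0 g0 d d0; have a10 : 0 < `|a| + 1 by rewrite ltr_wpDl.
have d20 : 0 < d / 2 by rewrite divr_gt0.
have df0 := divr_gt0 d20 a10.
apply: sub_finite_set (_ : finite_set ([set i | d / 2 / (`|a| + 1) <= `|f i|]
  `|`
    [set i | d / 2 <= `|g i|])); last first.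
  by rewrite finite_setU; split; [exact: f0 | exact: g0].
move=> i /= di; have real x := normr_real (x : C).
have [fi|fi] := real_leP (gtr0_real df0) (real (f i)); first by left.
have [gi|gi] := real_leP (gtr0_real d20) (real (g i)); first by right.
suff : d < d by rewrite ltxx.
by apply: le_lt_trans di _; apply: (@norm_axpy_lt _ C^o).
Qed.

Lemma c0_mul (f g : I -> C) : carrier c0 f -> carrier c0 g ->
  carrier c0 (fun i => f i * g i).
Proof.
move=> /c0_bounded[c c_gt0 fc] g0; apply: (c0_dominated c_gt0 g0) => i.
by rewrite normrM ler_wpM2r.
Qed.

Lemma c0_conj (f : I -> C) : carrier c0 f -> carrier c0 (fun i =>
  Num.conj (f i)).
Proof. by move=> f0; apply: (c0_dominated ltr01 f0) => i;
  rewrite norm_conjC mul1r. Qed.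

Lemma l2_eq_operator (W : normedModType C) (T U : L -> W) :
  bounded_operator T -> bounded_operator U -> (forall i, T (e i) = U (e i)) ->
    T =1 U.
Proof.
move=> Tb Ub TU; apply: (bounded_eq_total hL.2 Tb Ub) => _ [i _ <-].
exact: TU.
Qed.

Lemma multiplication_representation : exists M : c0 -> L -> L,
  representation M /\ forall f i, carrier c0 f -> M f (e i) = f i *: e i.
Proof.
have [e_orth e_total] := hL.
(* One-dimensional slots: the Schur test is applied to the diagonal matrix of [f]. *)
pose j (i : I) (z : C^o) := z *: e i.
have j_lin i : linear (j i).
  by move=> a x y; rewrite /j scalerDl scalerA.
have j_orth x y (v w : C^o) : inner (j x v) (j y w) = (x == y)%:R *
  (v * Num.conj w).
  by rewrite innerZl innerZr e_orth [RHS]mulrC -mulrA.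
have j_total : dense (lspan [set z | exists x v, z = j x v]).
  apply: dense_lspan_trans e_total _ => _ [i _ <-]; apply: sub_closure_span.
  by exists i, 1; rewrite /j scale1r.
have /choice[M MP] : forall f, exists T : L -> L, carrier c0 f ->
    bounded_operator T /\ forall i, T (e i) = f i *: e i.
  move=> f; have [f0|] := pselect (carrier c0 f); last by exists id.
  have [c c_gt0 fc] := c0_bounded f0.
  pose m x y : C := (x == y)%:R * f y.
  have m_diag x y : x != y -> m x y = 0 by rewrite /m => /negPf->;
    rewrite mul0r.
  have m_le x : `|m x x| <= c by rewrite /m eqxx mul1r.
  have row x r : uniq r -> \sum_(y <- r) `|m x y| <= c.
    move=> r_uniq; have [xr|xr] := boolP (x \in r).
      rewrite (bigD1_seq x)//= big1 ?addr0// => y yx.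
      by rewrite m_diag ?normr0// eq_sym.
    rewrite big_seq big1 ?(ltW c_gt0)// => y yr; rewrite m_diag ?normr0//.
    by apply: contra xr => /eqP->.
  have col y r : uniq r -> \sum_(x <- r) `|m x y| <= c.
    move=> r_uniq; have [yr|yr] := boolP (y \in r).
      rewrite (bigD1_seq y)//= big1 ?addr0// => x xy.
      by rewrite m_diag ?normr0.
    rewrite big_seq big1 ?(ltW c_gt0)// => x xr; rewrite m_diag ?normr0//.
    by apply: contra yr => /eqP<-.
  have m_fin y : finite_set [set x | m x y != 0].
    apply: sub_finite_set (finite_set1 y) => x /=.
    by have [//|xy] := eqVneq x y; rewrite m_diag// eqxx.
  have [T [Tb TE]] := schur_operator j_lin j_orth c_gt0 row col j_total m_fin.
  exists T => _; split=> // i; have -> : e i = j i 1 by rewrite /j scale1r.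
  rewrite TE (fsumT_seq (r := [:: i]))//.
    by rewrite big_seq1 /m eqxx mul1r.
  by move=> x; rewrite inE => xi; rewrite m_diag// scale0r.
have Mb f (f0 : carrier c0 f) := (MP f f0).1.
have ME f i (f0 : carrier c0 f) : M f (e i) = f i *: e i := (MP f f0).2 i.
exists M; split; last by move=> f i f0; apply: ME.
split; first split=> //.
- move=> z f g v f0 g0; have fg0 := c0_axpy z f0 g0.
  apply: (l2_eq_operator (Mb _ fg0) (bounded_axpy z (Mb _ f0) (Mb _ g0))) => i.
  by rewrite !ME// scalerA -scalerDl.
- move=> f g v f0 g0; have fg0 := c0_mul f0 g0.
  apply: (l2_eq_operator (Mb _ fg0) (bounded_comp (Mb _ f0) (Mb _ g0))) => i /=.
  rewrite (ME _ _ fg0) (ME _ _ g0) (linear_propZ (Mb _ f0).1) ME// scalerA.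
  by rewrite mulrC.
- move=> f v w f0; have f'0 := c0_conj f0.
  apply: (adjoint_total (Mb _ f'0) (Mb _ f0) e_total e_total) =>
    _ _ [i _ <-] [k _ <-].
  rewrite (ME _ _ f'0) ME// innerZl innerZr e_orth.
  by have [->//|_] := eqVneq i k; rewrite !mulr0.
apply: dense_lspan_trans e_total _ => _ [i _ <-]; apply: sub_closure_span.
have p0 := @c0_pointmass R I i.
by exists (pointmass R i), (e i); rewrite ME// /pointmass eqxx scale1r.
Qed.

End L2Representations.

(** * The quasi-regular representation of C*(G) *)

Section QuasiRegular.
Variables (R : realType) (G : groupType) (H : groupClosed G).
Variables (A : cstar_algebra R) (u : G -> A).
Variables (L : hilbert R) (e : lcosets H -> L).
Hypotheses (hA : group_cstar u) (hL : l2_space e).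

Lemma quasi_regular_representation : exists lambda : cstar_alg A -> L -> L,
  representation lambda /\
  forall x y, lambda (u x) (e y) = e (lcoset_act x y).
Proof.
have [e_orth e_total] := hL; have [_ _ _ _ universal] := hA.
have /choice[U UP] : forall x, exists U : L -> L, [/\ bounded_operator U,
    forall v w, inner (U v) (U w) = 1 * inner v w
    & forall y, U (e y) = e (lcoset_act x y)].
  move=> x; apply: (gram_extension ler01 _ e_total) => y z.
  by rewrite !e_orth (inj_eq (can_inj (lcoset_actK x))) mul1r.
have Ub x : bounded_operator (U x) by have [] := UP x.
have UE x y : U x (e y) = e (lcoset_act x y) by have [] := UP x.
have UM x y v : U (x * y)%g v = U x (U y v).
  apply: (l2_eq_operator hL (Ub _) (bounded_comp (Ub x) (Ub y))) => z /=.
  by rewrite !UE lcoset_actM.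
have U1 v : U 1%g v = v.
  apply: (l2_eq_operator hL (Ub _) (@bounded_id _ _)) => z /=.
  by rewrite UE lcoset_act1.
have [|lambda [lambda_rep lambdaE]] := universal L U.
  split=> // x; split; first exact: (Ub x).1.
    by move=> v w; have [_ -> _] := UP x; rewrite mul1r.
  by move=> w; exists (U x^-1%g w); rewrite -UM mulgV U1.
by exists lambda; split=> // x y; rewrite lambdaE UE.
Qed.

End QuasiRegular.

(** * Matrix units of a covariant pair *)

Section MatrixUnits.
Variables (R : realType) (G : groupType) (H : groupClosed G).
Hypothesis hH : hecke_pair H.
Local Notation C := R[i].
Local Notation HA := (hecke_algebra H R).
Local Notation c0 := (c0 R (lcosets H)).
Local Notation dcb := (@dcoset_between G H).
Variables (K : hilbert R) (nu : c0 -> K -> K) (V : HA -> K -> K).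
Hypotheses (nu_rep : representation nu) (V_rep : hecke_rep V).
Hypothesis nuV : covariant_pair nu V.
Implicit Types (x y z : lcosets H) (v w : K).

Definition matrix_unit x y v : K :=
  nu (pointmass R x) (V (pointmass R (dcb x y)) (nu (pointmass R y) v)).

Local Notation E := matrix_unit.

Lemma matrix_unit_bounded x y : bounded_operator (E x y).
Proof.
have [nub _ _ _] := nu_rep.1; have [[Vb _ _ _] _] := V_rep.
have Vxy : bounded_operator (V (pointmass R (dcb x y))).
  exact: Vb _ (hecke_char_carrier R H _).
exact: (bounded_comp (nub _ (c0_pointmass _)) (bounded_comp Vxy
  (nub _ (c0_pointmass _)))).
Qed.

Lemma matrix_unit_diag x v : E x x v = nu (pointmass R x) v.
Proof.
have [_ V1] := V_rep.
by rewrite /E dcoset_between_id V1 pointmass_proj.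
Qed.

(** In the covariance relation based at [y], the outer point masses at [x] and [z] leave only the
    term with [y u = x] and [y v = z], and its Hecke element is that of the pair [(x, z)] by
    invariance. *)
Lemma matrix_unitM x y z v : E x y (E y z v) = E x z v.
Proof.
have [nub _ _ _] := nu_rep.1; have [[Vb _ _ _] _] := V_rep.
have nulin y' := (nub _ (@c0_pointmass R _ y')).1.
rewrite /E pointmass_proj//.
set k := nu (pointmass R z) v.
have := nuV ((repr x)^-1 * repr y)%g (repr y) ((repr y)^-1 * repr z)%g k.
rewrite lcoset_reprK -[hecke_char _ _ _]/(pointmass R (dcb x y)).
rewrite -[hecke_char _ _ ((repr y)^-1 * _)%g]/(pointmass R (dcb y z)) => ->.
have [sa [sa_uniq saP saE]] := @fsum_seq _ K _
  (hH (dcoset H ((repr x)^-1 * repr y)^-1%g)).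
have [sb [sb_uniq sbP sbE]] :=
  @fsum_seq _ K _ (hH (dcoset H ((repr y)^-1 * repr z)%g)).
rewrite saE (linear_prop_sum (nulin x)).
(* The indices of the surviving term. *)
pose p0 := lcoset_act (repr y)^-1%g x; pose q0 := lcoset_act (repr y)^-1%g z.
have act_repr z' : dcoset H (repr (lcoset_act (repr y)^-1%g z')) = dcb y z'.
  by rewrite -dcoset_between1 -{2}(lcoset_act_repr y) -{2}[z'](lcoset_actKV
    (repr y)) dcoset_between_act.
have p0_in : p0 \in sa.
  apply/saP/lcosets_inP; rewrite act_repr /dcoset_between.
  by rewrite invgM invgK.
have q0_in : q0 \in sb by apply/sbP/lcosets_inP; rewrite act_repr.
rewrite (bigD1_seq p0)//= [X in _ + X]big1 ?addr0 => [|p pp0]; last first.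
  rewrite sbE !(linear_prop_sum (nulin x)) big1// => q _.
  rewrite pointmass_orth//; apply: contra pp0 => /eqP xE.
  by rewrite /p0 xE lcoset_actK.
rewrite sbE !(linear_prop_sum (nulin x)) (bigD1_seq q0)//= big1 ?addr0 =>
  [|q qq0]; last first.
  rewrite /k [X in V _ X]pointmass_orth//.
    by rewrite (linear_prop0 (Vb _ (hecke_char_carrier R H _)).1) !(linear_prop0
      (nulin _)).
  by apply: contra qq0 => /eqP zE; rewrite /q0 -zE lcoset_actK.
rewrite !lcoset_actKV !pointmass_proj//.
by rewrite -[hecke_char _ _ _]/(pointmass R (dcb p0 q0)) dcoset_between_act.
Qed.

Lemma matrix_unit_orth x y z z' v : y != z -> E x y (E z z' v) = 0.
Proof.
have [nub _ _ _] := nu_rep.1; have [[Vb _ _ _] _] := V_rep.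
move=> yz; rewrite /E pointmass_orth//.
rewrite (linear_prop0 (Vb _ (hecke_char_carrier R H _)).1).
exact: (linear_prop0 (nub _ (c0_pointmass _)).1).
Qed.

Lemma matrix_unit_adj x y v w : inner (E x y v) w = inner v (E y x w).
Proof.
have [[_ _ _ Vadj] _] := V_rep.
rewrite /E (pointmass_adj nu_rep).
have charE := hecke_char_star R H ((repr y)^-1 * repr x)%g.
rewrite invgM invgK in charE.
rewrite -[pointmass R (dcb x y)]charE Vadj; last exact: hecke_char_carrier.
by rewrite (pointmass_adj nu_rep).
Qed.

(** Each [nu(eps_y)] factors through the base coset, and the ranges of the point masses are
    total. *)
Lemma matrix_unit_total :
  dense (lspan [set w | exists y v, w = E y (lcoset H 1%g) (E (lcoset H 1%g) y
    v)]).
Proof.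
apply: dense_lspan_trans (c0_rep_total nu_rep) _ => _ [y [v ->]].
apply: sub_closure_span; exists y, v.
by rewrite matrix_unitM matrix_unit_diag.
Qed.

End MatrixUnits.

(** * From a covariant pair to regularity *)

Section CovariantImpliesRegular.
Variables (R : realType) (G : groupType) (H : groupClosed G).
Variables (A B T : cstar_algebra R) (u : G -> A) (t : B -> A -> T) (delta : B ->
  T).
Hypotheses (hA : group_cstar u) (hT : min_tensor t) (hdelta :
  coaction u t delta).
Hypotheses (hmax : maximal u t delta) (hH : hecke_pair H).
Variables (K : hilbert R) (pi : cstar_alg B -> K -> K).
Variables (nu : c0 R (lcosets H) -> K -> K).
Hypothesis hpinu : covariant_rep u t delta pi nu.
Variable V : hecke_algebra H R -> K -> K.
Hypotheses (V_rep : hecke_rep V) (nuV : covariant_pair nu V).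
Hypothesis V_pi : forall (f : hecke_algebra H R) (b : B) (v : K),
  carrier (hecke_algebra H R) f -> V f (pi b v) = pi b (V f v).
Local Notation C := R[i].
Local Notation E := (matrix_unit nu V).
Local Notation o := (lcoset H 1%g).
Local Notation Gamma := (sections u t delta).

Let pi_star : star_rep pi. Proof. by case: hpinu => -[]. Qed.
Let nu_rep : representation nu. Proof. by case: hpinu. Qed.
Let pi_b b : bounded_operator (pi b). Proof. by case: pi_star => + _ _ _;
  apply. Qed.
Let E_b x y : bounded_operator (E x y).
Proof. exact: matrix_unit_bounded. Qed.
Let E_lin x y : linear (E x y). Proof. by have [] := E_b x y. Qed.
Let EM x y z v : E x y (E y z v) = E x z v.
Proof. exact: matrix_unitM. Qed.

(** As [pi b] commutes with [V], it only moves the two point masses, and the Hecke element between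
    them depends on their relative position alone. *)
Lemma spectral_matrix_unit x b y z v : spectral u t delta x b ->
  pi b (E y z v) = E (lcoset_act x y) (lcoset_act x z) (pi b v).
Proof.
move=> bx; have [_ _ pinu] := hpinu.
rewrite /matrix_unit (pinu _ _ _ _ bx) -V_pi; last exact: hecke_char_carrier.
by rewrite (pinu _ _ _ _ bx) dcoset_between_act.
Qed.

Lemma spectral0 x : spectral u t delta x 0.
Proof.
have [[dlin _ _] _ _ _] := hdelta; have [[_ t_linl] _ _ _ _] := hT.
rewrite /spectral /= (linear_prop0 (t_linl _)).
by have := dlin (-1) 0 0 Logic.I Logic.I; rewrite scaler0 addr0 scaleN1r addNr.
Qed.

Definition corner : hilbert R := fixed_hilbert (matrix_unit_bounded nu_rep V_rep
  o o).

Lemma cornerP (v : corner) : E o o (val v) = val v.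
Proof. exact: fixed_spaceP. Qed.

Lemma corner_idem v : E o o v \in fixed_by (matrix_unit_bounded nu_rep V_rep o
  o).
Proof. by apply/eqP; rewrite EM. Qed.

Definition to_corner (v : K) : corner :=
  exist _ (E o o v) (corner_idem v) : fixed_space _.

Lemma val_to_corner v : val (to_corner v) = E o o v.
Proof. by []. Qed.

Lemma corner_inner (v w : corner) : inner v w = inner (val v) (val w).
Proof. by []. Qed.

Lemma to_corner_bounded : bounded_operator to_corner.
Proof.
have [Elin [M EM']] := E_b o o; split; last by exists M.
by move=> a x y; apply: val_inj; exact: Elin.
Qed.

Lemma val_bounded : bounded_operator (fun v : corner => val v : K).
Proof. by split=> //; exists 1 => v; rewrite mul1r. Qed.

(** The vector that will be [v (x) eps_y]. *)
Definition amplify y (v : corner) : K := E y o (val v).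

Lemma amplify_linear y : linear (amplify y).
Proof. exact: (bounded_comp (E_b y o) val_bounded).1. Qed.

Lemma amplify_orth x y v w :
  inner (amplify x v) (amplify y w) = (x == y)%:R * inner v w.
Proof.
rewrite /amplify (matrix_unit_adj nu_rep V_rep).
have [->|xy] := eqVneq x y; first by rewrite EM cornerP mul1r.
by rewrite (matrix_unit_orth nu_rep V_rep)// inner0r mul0r.
Qed.

Lemma amplify_total : dense (lspan [set z | exists x v, z = amplify x v]).
Proof.
apply: dense_lspan_trans (matrix_unit_total hH nu_rep V_rep nuV) _.
move=> _ [y [v ->]]; apply: sub_closure_span.
exists y, (to_corner (E o y v)); by rewrite /amplify val_to_corner [E o o _]EM.
Qed.

Definition corner_term x b v : K := E o (lcoset_act x o) (pi b v).

Lemma corner_term_b x b : bounded_operator (corner_term x b).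
Proof. exact: (bounded_comp (E_b _ _) (pi_b b)). Qed.

Lemma corner_term0 x v : corner_term x 0 v = 0.
Proof.
by rewrite /corner_term (star_rep0 pi_star)// (linear_prop0 (E_lin _ _)).
Qed.

Lemma corner_termD x (z : C) b c v :
  corner_term x (z *: b + c) v = z *: corner_term x b v + corner_term x c v.
Proof.
have [_ piZD _ _] := pi_star.
by rewrite /corner_term piZD// E_lin.
Qed.

(** Moving [pi b] past [E o (y o)] turns the latter into [E (x o) (x y o)], which composes with
    [E o (x o)]. *)
Lemma corner_termM x y b c v : spectral u t delta x b ->
  corner_term x b (corner_term y c v) = corner_term (x * y)%g (cmul b c) v.
Proof.
move=> bx; have [_ _ piM _] := pi_star; rewrite /corner_term.
rewrite (spectral_matrix_unit _ _ _ bx) EM -lcoset_actM.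
by rewrite -[pi (cmul b c) v]/(pi (smul (b : cstar_alg B) c) v) piM.
Qed.

Lemma corner_term_adj x b v w : spectral u t delta x b -> E o o w = w ->
  inner (corner_term x^-1%g (cstar b) v) w = inner v
    (E o o (corner_term x b w)).
Proof.
move=> bx ww; have [_ _ _ piV] := pi_star; rewrite /corner_term EM.
rewrite (matrix_unit_adj nu_rep V_rep).
rewrite -[cstar b]/(sstar (b : cstar_alg B)) piV//; congr (inner v _).
rewrite (spectral_matrix_unit _ _ _ bx) -lcoset_actM mulgV lcoset_act1.
by [].
Qed.

(** Each term already lies in the corner, so [to_corner] changes the type and not the value. *)
Definition section_rep (f : Gamma) (v : corner) : corner :=
  to_corner (\sum_(x \in [set: G]) corner_term x (f x) (val v)).

Lemma section_seq (f : Gamma) : carrier Gamma f ->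
  exists2 r : seq G, uniq r & forall x, x \notin r -> f x = 0.
Proof.
move=> [_ /finite_seqP[r rE]]; exists (undup r); first exact: undup_uniq.
move=> x; rewrite mem_undup => xr; apply: contrapT => fx; case/negP: xr.
by have : [set` r] x by rewrite -rE.
Qed.

Lemma section_repE (f : Gamma) r v : uniq r -> (forall x, x \notin r ->
  f x = 0) ->
  val (section_rep f v) = \sum_(x <- r) corner_term x (f x) (val v).
Proof.
move=> r_uniq rP; rewrite /section_rep val_to_corner (fsumT_seq r_uniq);
  last first.
  by move=> x xr; rewrite rP// corner_term0.
rewrite (linear_prop_sum (E_lin _ _)); apply: eq_bigr => x _.
by rewrite /corner_term EM.
Qed.

Definition single x (b : B) : Gamma := fun y => if y == x then b else 0.

Lemma single_carrier x b : spectral u t delta x b -> carrier Gamma (single x b).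
Proof.
move=> bx; split=> [y|].
  by rewrite /single; case: eqP => [->|_] //; apply: spectral0.
apply: sub_finite_set (finite_set1 x) => y /=.
by rewrite /single; case: eqP.
Qed.

Lemma section_rep_single x b v :
  val (section_rep (single x b) v) = corner_term x b (val v).
Proof.
rewrite (@section_repE _ [:: x])// => [|y];
  first by rewrite big_seq1 /single eqxx.
by rewrite inE /single => /negPf->.
Qed.

Lemma section_rep_star : star_rep section_rep.
Proof.
split.
- move=> f ff; have [r r_uniq rP] := section_seq ff.
  have in_b : bounded_operator (fun v : K =>
    \sum_(x <- r) corner_term x (f x) v).
    by apply: bounded_sum => x; apply: corner_term_b.
  have sum_b : bounded_operator (fun v : corner =>
      to_corner (\sum_(x <- r) corner_term x (f x) (val v))).
    exact: (bounded_comp to_corner_bounded (bounded_comp in_b val_bounded)).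
  suff -> : section_rep f = fun v : corner =>
      to_corner (\sum_(x <- r) corner_term x (f x) (val v)) by [].
  apply/funext => v; rewrite /section_rep (fsumT_seq r_uniq)// => x xr.
  by rewrite rP// corner_term0.
- move=> z f g v ff fg; have [r r_uniq rP] := section_seq ff.
  have [s s_uniq sP] := section_seq fg; pose q := undup (r ++ s).
  have q_uniq : uniq q by exact: undup_uniq.
  have fq x : x \notin q -> f x = 0.
    by rewrite mem_undup mem_cat negb_or => /andP[/rP].
  have gq x : x \notin q -> g x = 0.
    by rewrite mem_undup mem_cat negb_or => /andP[_ /sP].
  apply: val_inj;
    rewrite -[RHS]/(z *: val (section_rep f v) + val (section_rep g v)).
  rewrite !(@section_repE _ q)//; last first.
    by move=> x xq; rewrite -[LHS]/(z *: f x + g x) fq// gq// scaler0 addr0.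
  rewrite scaler_sumr -big_split; apply: eq_bigr => x _.
  exact: corner_termD.
- move=> f g v ff fg; have [r r_uniq rP] := section_seq ff.
  have [s s_uniq sP] := section_seq fg.
  (* Contains the support of the convolution, and every point that the double sum can reach. *)
  pose q := undup [seq (x * y)%g | x <- r, y <- s].
  have q_uniq : uniq q by exact: undup_uniq.
  have fgE x : smul f g x = \sum_(y <- r) cmul (f y) (g (y^-1 * x)%g).
    apply: fsumT_seq => // y yr; rewrite rP//.
    exact: (linear_prop0 (cmul_linearl _)).
  have gq x y : x \in r -> y \notin q -> g (x^-1 * y)%g = 0.
    move=> xr yq; apply: sP; apply: contra yq => xys.
    rewrite mem_undup; apply/allpairsP; exists (x, (x^-1 * y)%g).
    by rewrite /= mulVKg.
  apply: val_inj; rewrite (@section_repE _ q)//; last first.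
    move=> x xq; rewrite fgE big_seq big1// => y yr; rewrite gq//.
    exact: (linear_prop0 (cmul_linearr _)).
  rewrite (@section_repE f r)//.
  under eq_bigr => x _.
    rewrite fgE (linear_prop_sum (f := fun b : B => corner_term x b (val v)));
      last by move=> z b c; apply: corner_termD.
    over.
  rewrite exchange_big; apply: eq_big_seq => x xr.
  rewrite (@section_repE g s)// (linear_prop_sum (corner_term_b _ _).1).
  rewrite -(@fsumT_seq _ _ q (fun y =>
    corner_term y (cmul (f x) (g (x^-1 * y)%g)) (val v)))//; last first.
    by move=> y yq; rewrite gq// (linear_prop0 (cmul_linearr _)) corner_term0.
  (* Substituting [x y] for [y] turns the summand into a product of a term of [f] and a term of
     [g]. *)
  have x_bij : bijective (fun y => x * y)%g.
    by exists (fun y => x^-1 * y)%g => y; rewrite ?mulKg ?mulVKg.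
  rewrite (reindex_fsbigT (fun y => x * y)%g _ x_bij).
  rewrite (@fsumT_seq _ _ s)//; last first.
    by move=> y ys; rewrite mulKg sP// (linear_prop0 (cmul_linearr _))
      corner_term0.
  apply: eq_bigr => y _; rewrite mulKg corner_termM//.
  by case: ff => + _; apply.
- move=> f v w ff; have [r r_uniq rP] := section_seq ff.
  rewrite !corner_inner (@section_repE f r)//.
  rewrite (@section_repE _ [seq x^-1%g | x <- r]); last 2 first.
  + by rewrite map_inj_uniq//; apply: invg_inj.
  + move=> x xr; rewrite /= rP ?cstar0//; apply: contra xr => xr.
    by apply/mapP; exists x^-1%g; rewrite ?invgK.
  rewrite big_map inner_suml inner_sumr; apply: eq_bigr => x _.
  rewrite /= invgK corner_term_adj ?cornerP//; last by case: ff => + _; apply.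
  by rewrite /corner_term EM.
Qed.

Lemma section_rep_representation : representation section_rep.
Proof.
split; first exact: section_rep_star.
have [[_ pi_nd] _ _] := hpinu.
have corner_total : dense (lspan [set w | exists b v, w = to_corner (pi b v)]).
  apply/denseP => v d d0.
  have : closure_span [set w | exists b v, w = to_corner (pi b v)]
    (to_corner (val v)).
    apply: (bounded_closure_span to_corner_bounded pi_nd) => _ [b [k [_ ->]]].
    by apply: sub_closure_span; exists b, k.
  have -> : to_corner (val v) = v by apply: val_inj; exact: cornerP.
  exact.
apply: dense_lspan_trans corner_total _ => _ [b [k ->]].
have pik_b : bounded_operator (fun b : B => to_corner (pi b k)).
  exact: (bounded_comp to_corner_bounded (cstar_rep_bounded_operator k
    pi_star)).
move: b; apply: (bounded_closure_span pik_b (spectral_total hmax)) => b [x bx].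
apply: sub_closure_span.
(* Chosen so that [x] carries it to [o]: then [pi b (E o y k)] is [E (x o) o (pi b k)], and applying
   [E o (x o)] gives [E o o (pi b k)]. *)
pose y := lcoset_act x^-1%g o.
exists (single x b), (to_corner (E o y k)); split; first exact: single_carrier.
apply: val_inj; rewrite section_rep_single !val_to_corner EM /corner_term.
by rewrite (spectral_matrix_unit _ _ _ bx) EM /y lcoset_actKV.
Qed.

Lemma corner_representation : exists theta : cstar_alg B -> corner -> corner,
  representation theta /\
  forall x b v, spectral u t delta x b ->
    val (theta b v) = corner_term x b (val v).
Proof.
have [_ _ universal] := hmax.
have [theta [theta_rep thetaE]] := universal _ _ section_rep_representation.
exists theta; split=> // x b v bx; rewrite -section_rep_single.
rewrite -thetaE; last exact: single_carrier.
congr (val (theta _ v)); rewrite (@fsumT_seq _ _ [:: x])//.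
  by rewrite big_seq1 /single eqxx.
by move=> y; rewrite inE /single => /negPf->.
Qed.

Variables (L : hilbert R) (e : lcosets H -> L).
Hypothesis hL : l2_space e.

(** [K] itself serves as the tensor product. Each [s v] is built separately as an isometry scaled by
    [|v|]; linearity in [v] is then checked on the basis of [L]. *)
Lemma corner_tensor : exists s : corner -> L -> K,
  hilbert_tensor s /\ forall v y, s v (e y) = amplify y v.
Proof.
have [e_orth e_total] := hL.
have /choice[s sP] : forall v : corner, exists D : L ->
  K, [/\ bounded_operator D,
    forall w w', inner (D w) (D w') = inner v v * inner w w'
    & forall y, D (e y) = amplify y v].
  move=> v; apply: gram_extension e_total;
    first by rewrite -inner_norm exprn_ge0.
  by move=> x y; rewrite amplify_orth e_orth mulrC.
have sb v : bounded_operator (s v) by have [] := sP v.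
have sE v y : s v (e y) = amplify y v by have [] := sP v.
exists s; split=> //; split.
- by move=> v; have [] := sb v.
- move=> w a v v';
  apply: (l2_eq_operator hL (sb _) (bounded_axpy a (sb v) (sb v'))) => y.
  by rewrite !sE amplify_linear.
- move=> v w v' w'; rewrite -innerZl.
  have scale_b : bounded_operator (fun w : L => inner v v' *: w).
    have := bounded_axpy (inner v v') (@bounded_id _ L) (@bounded_zero _ L L).
    by under eq_fun do rewrite addr0.
  apply: (form_total (sb v) (sb v') scale_b (@bounded_id _ L) e_total e_total).
  by move=> _ _ [x _ <-] [y _ <-];
    rewrite !sE amplify_orth innerZl e_orth mulrC.
apply: dense_lspan_trans amplify_total _ => _ [x [v ->]].
by apply: sub_closure_span; exists v, (e x); rewrite sE.
Qed.

Variables (X : cstar_algebra R) (iota : gsections u t delta H -> X).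
Variable Phi : cstar_alg X -> K -> K.
Hypothesis hPhi : integrated_form iota pi nu Phi.

Lemma covariant_implies_regular : regular iota e Phi.
Proof.
have [theta [theta_rep thetaE]] := corner_representation.
have [s [s_tensor sE]] := corner_tensor.
have [lambda [lambda_rep lambdaE]] := quasi_regular_representation hA hL.
have [Th [Th_rep ThE]] := tensor_representation hT s_tensor theta_rep
  lambda_rep.
have [M [M_rep ME]] := multiplication_representation hL.
have [[nub _ _ _] _] := nu_rep; have [[Mb _ _ _] _] := M_rep.
have [[Thb _ _ _] _] := Th_rep; have [Phi_rep PhiE] := hPhi.
exists corner, theta, s; split=> //; exists lambda, Th, M, nu; split=> //.
  (* [nu] itself acts as [1 (x) M]: on the slot [y] both multiply by [f y]. *)
  split=> // f v w f0.
  apply: (l2_eq_operator hL (bounded_comp (nub _ f0) (tensor_bounded_r v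
    s_tensor))
    (bounded_comp (tensor_bounded_r v s_tensor) (Mb _ f0))) => y /=.
  rewrite ME// (linear_propZ (tensor_bounded_r v s_tensor).1) sE.
  by rewrite /amplify /matrix_unit c0_rep_eval.
split=> // x y b v bx; rewrite (PhiE _ _ _ _ bx).
(* On the slot [z] the identity of [pi b] with [Th (delta b)] is the factorisation of
   [E (x z) (x o)] through [o]. *)
apply: (bounded_eq_total amplify_total (pi_b b) (Thb (delta b) Logic.I)).
move=> _ [z [w ->]]; rewrite -sE bx ThE lambdaE !sE /amplify (thetaE _ _ _ bx).
by rewrite (spectral_matrix_unit _ _ _ bx) /corner_term EM.
Qed.

End CovariantImpliesRegular.

Theorem theorem3p2 (R : realType) (G : groupType) (H : groupClosed G)
    (A B T : cstar_algebra R) (u : G -> A) (t : B -> A -> T) (delta : B -> T)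
    (X : cstar_algebra R) (iota : gsections u t delta H -> X)
    (L : hilbert R) (e : lcosets H -> L)
    (hA : group_cstar u) (hT : min_tensor t)
    (hdelta : coaction u t delta) (hmax : maximal u t delta)
    (hH : hecke_pair H)
    (hX : crossed_product iota) (hL : l2_space e)
    (K : hilbert R) (pi : cstar_alg B -> K -> K)
    (nu : c0 R (lcosets H) -> K -> K) (Phi : cstar_alg X -> K -> K)
    (hpinu : covariant_rep u t delta pi nu)
    (hPhi : integrated_form iota pi nu Phi) :
  (exists (S : hilbert R) (Psi : cstar_alg X -> S -> S),
      regular iota e Psi /\ unitarily_equivalent Phi Psi)
  <->
  (exists V : hecke_algebra H R -> K -> K,
      [/\ hecke_rep V, covariant_pair nu V
        & forall (f : hecke_algebra H R) (b : B) (v : K),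
            carrier (hecke_algebra H R) f -> V f (pi b v) = pi b (V f v)]).
Proof.
split; first exact: (regular_implies_covariant hmax hH hL hpinu hPhi).
move=> [V [V_rep nuV V_pi]]; exists K, Phi; split.
  exact: (covariant_implies_regular hA hT hdelta hmax hH hpinu V_rep nuV V_pi hL
    hPhi).
(* [Phi] is itself regular on [K], so the equivalence is the identity. *)
by exists id; split=> //; split=> // w; exists w.
Qed.
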